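(* Let $d\ge 1$, let $(\chi,\mathcal{A}_\chi,\mu)$ be a $\sigma$-finite measure space, and let $p:\mathbb{T}^d\times\chi\to\mathbb{R}_{\ge 0}$ be jointly measurable with $\int_\chi p(\mathbf{x},y)\,\mu(dy)=1$ for all $\mathbf{x}\in\mathbb{T}^d$. Let $\mathcal{A}$ be the ABLE transformation, $f\mapsto \hat f$ with $\hat f_{\mathbf{k},y}=\langle f,e_{\mathbf{k},y}\rangle$ for $f\in L^2(\mathbb{T}^d,\mathbb{C})$, $\mathbf{k}\in\mathbb{Z}^d$, $y\in\chi$. Then $\mathcal{A}$ maps $L^2(\mathbb{T}^d,\mathbb{C})$ into $L^2(\mathbb{Z}^d\times\chi)$, it is a bijection from $L^2(\mathbb{T}^d,\mathbb{C})$ onto its image $\mathrm{Im}(\mathcal{A})\subset L^2(\mathbb{Z}^d\times\chi)$, and it is an isometry: for every $f\in L^2(\mathbb{T}^d,\mathbb{C})$, $$\|f\|_{L^2(\mathbb{T}^d)}^2=\|\hat f\|_{L^2(\mathbb{Z}^d\times\chi)}^2=\int_\chi\sum_{\mathbf{k}\in\mathbb{Z}^d}|\hat f_{\mathbf{k},y}|^2\,\mu(dy).$$ Moreover, the inverse $\mathcal{A}^{-1}:\mathrm{Im}(\mathcal{A})\to L^2(\mathbb{T}^d,\mathbb{C})$ is given, for a.e. $\mathbf{x}\in\mathbb{T}^d$, by $$\mathcal{A}^{-1}(\hat f)(\mathbf{x})=\int_\chi\Big(\sum_{\mathbf{k}\in\mathbb{Z}^d}\hat f_{\mathbf{k},y}\,e^{i\mathbf{k}\cdot\mathbf{x}}\Big)\sqrt{p(\mathbf{x},y)}\,\mu(dy),$$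 where for $\mu$-a.e. $y$ the inner series converges in $L^2(\mathbb{T}^d)$.
   Context: $\mathbb{T}^d=\mathbb{R}^d/(2\pi\mathbb{Z})^d$. On $L^2(\mathbb{T}^d,\mathbb{C})$ use the normalized inner product $\langle f,g\rangle=\frac{1}{(2\pi)^d}\int_{\mathbb{T}^d}f(\mathbf{x})\overline{g(\mathbf{x})}\,d\mathbf{x}$ and the associated norm. The adaptive learnable basis attached to $p$ is the family $e_{\mathbf{k},y}(\mathbf{x})=\sqrt{p(\mathbf{x},y)}\,e^{i\mathbf{k}\cdot\mathbf{x}}$, $\mathbf{k}\in\mathbb{Z}^d$, $y\in\chi$. Thus $\hat f_{\mathbf{k},y}=\frac{1}{(2\pi)^d}\int_{\mathbb{T}^d} f(\mathbf{x})\sqrt{p(\mathbf{x},y)}\,e^{-i\mathbf{k}\cdot\mathbf{x}}\,d\mathbf{x}$, which is defined for every $y$ with $\sqrt{p(\cdot,y)}f\in L^2(\mathbb{T}^d)$, hence for $\mu$-a.e. $y$. $L^2(\mathbb{Z}^d\times\chi)$ is taken with respect to (counting measure)$\,\otimes\,\mu$, and its elements are identified when they agree almost everywhere. *)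

(* Defs.v *)
(* MathComp-Analysis, over an abstract R : realType; complex numbers are the
   R[i] of mathcomp-real-closed. *)
From HB Require Import structures.
From mathcomp Require Import all_boot all_order all_algebra finmap.
From mathcomp Require Import complex.
From mathcomp Require Import all_classical all_reals all_analysis.

Set Implicit Arguments.
Unset Strict Implicit.
Unset Printing Implicit Defensive.
Import Order.TTheory GRing.Theory Num.Theory.
Import numFieldNormedType.Exports.
Import ComplexField.Normc.

Local Open Scope classical_set_scope.
Local Open Scope ring_scope.
Local Open Scope complex_scope.
Local Open Scope quotient_scope.

Section complex_integration.
Context d (T : measurableType d) (R : realType).
Variable mu : {measure set T -> \bar R}.
Implicit Types f g : T -> R[i].

(* Measurability for the Borel sigma-algebra of R[i], identified with R^2. *)
Definition cmeasurable f :=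
  measurable_fun setT (@complex.Re R \o f) /\ measurable_fun setT (@complex.Im R \o f).

Definition cintegrable f :=
  mu.-integrable setT (EFin \o @complex.Re R \o f) /\
  mu.-integrable setT (EFin \o @complex.Im R \o f).

Definition cintegral f : R[i] :=
  Rintegral mu setT (@complex.Re R \o f) +i* Rintegral mu setT (@complex.Im R \o f).

Definition inner f g : R[i] := cintegral (fun x => f x * (g x)^*).

Definition L2norm f : \bar R := 'N[mu]_2%:E[EFin \o (@normc R \o f)].

Definition square_integrable f :=
  cmeasurable f /\ finite_norm mu 2%:E (@normc R \o f).

Record L2fun := MkL2fun {
  L2fun_val :> T -> R[i];
  L2funP : square_integrable L2fun_val }.

HB.instance Definition _ := gen_eqMixin L2fun.
HB.instance Definition _ := gen_choiceMixin L2fun.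

Definition L2fun_eq (f g : L2fun) := `[< {ae mu, forall x, f x = g x} >].

Let L2fun_eq_refl : reflexive L2fun_eq.
Proof. by move=> f; apply/asboolP; exact: nearW. Qed.

Let L2fun_eq_sym : symmetric L2fun_eq.
Proof.
by move=> f g; apply/idP/idP => /asboolP fg; apply/asboolP;
  apply: filterS fg => x ->.
Qed.

Let L2fun_eq_trans : transitive L2fun_eq.
Proof.
move=> g f h /asboolP fg /asboolP gh; apply/asboolP.
by apply: filterS2 fg gh => x -> ->.
Qed.

Canonical L2fun_eq_canonical :=
  EquivRel L2fun_eq L2fun_eq_refl L2fun_eq_sym L2fun_eq_trans.

Definition L2space : Type := {eq_quot L2fun_eq}.
HB.instance Definition _ := Choice.on L2space.
HB.instance Definition _ := EqQuotient.on L2space.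

Definition L2class (f : L2fun) : L2space := \pi_L2space f.

(* An element of L2space is used as a function through a representative; only
   norms of such functions and almost everywhere statements about them are
   meaningful. *)
Definition L2space_fun (F : L2space) : L2fun := repr F.
Coercion L2space_fun : L2space >-> L2fun.

(* Convergence of the net of finite partial sums (unconditional convergence)
   towards s in the L2-norm. *)
Definition L2_has_sum (I : choiceType) (u : I -> T -> R[i]) (s : T -> R[i]) :=
  square_integrable s /\
  forall e : R, 0 < e -> exists A0 : {fset I}, forall A : {fset I},
    (A0 `<=` A)%fset ->
    (L2norm (fun x => (\sum_(i <- A) u i x) - s x)%R < e%:E)%E.

End complex_integration.

Lemma pushforward_semi_sigma_additive d1 d2 (T1 : measurableType d1)
    (T2 : measurableType d2) (R : realType) (m : {measure set T1 -> \bar R})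
    (f : T1 -> T2) :
  measurable_fun setT f -> semi_sigma_additive (pushforward m f).
Proof.
move=> mf F mF tF mUF; rewrite /pushforward preimage_bigcup.
have mpre A : measurable A -> measurable (f @^-1` A).
  by move=> mA; rewrite -[X in measurable X]setTI; exact: mf.
apply: measure_semi_sigma_additive => [n||]; first exact/mpre.
  apply/trivIsetP => i j _ _ ij; rewrite -preimage_setI.
  by move/trivIsetP : tF => ->//; rewrite preimage_set0.
by rewrite -preimage_bigcup; exact: mpre.
Qed.

Section lebesgue_tuple.
Variable R : realType.
Local Notation RR := (measurableTypeR R).

Definition tuple_cons n (z : RR * n.-tuple RR) : n.+1.-tuple RR :=
  [the n.+1.-tuple _ of z.1 :: z.2].

Lemma measurable_tuple_cons n : measurable_fun setT (@tuple_cons n).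
Proof. exact: measurable_cons. Qed.

Section lebesgue_cons.
Variables (n : nat) (m : {sigma_finite_measure set (n.-tuple RR) -> \bar R}).

Definition lebesgue_cons : set (n.+1.-tuple RR) -> \bar R :=
  pushforward (@lebesgue_measure R \x m)%E (@tuple_cons n).

Let lebesgue_cons0 : lebesgue_cons set0 = 0%E.
Proof. by rewrite /lebesgue_cons /pushforward preimage_set0 measure0. Qed.

Let lebesgue_cons_ge0 A : (0 <= lebesgue_cons A)%E.
Proof. by rewrite /lebesgue_cons /pushforward measure_ge0. Qed.

Let lebesgue_cons_sigma_additive : semi_sigma_additive lebesgue_cons.
Proof.
apply: pushforward_semi_sigma_additive; exact: measurable_tuple_cons.
Qed.

HB.instance Definition _ := isMeasure.Build _ _ _ lebesgue_cons
  lebesgue_cons0 lebesgue_cons_ge0 lebesgue_cons_sigma_additive.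

Let lebesgue_cons_sigma_finite : sigma_finite setT lebesgue_cons.
Proof.
have /sigma_finiteP[F [FT ndF Foo]] := sigma_finiteT (@lebesgue_measure R).
have /sigma_finiteP[G [GT ndG Goo]] := sigma_finiteT m.
pose uncons (t : n.+1.-tuple RR) : RR * n.-tuple RR :=
  (tnth t ord0, [tuple of behead t]).
have muncons : measurable_fun setT uncons.
  apply: measurable_fun_pair; first exact: measurable_tnth.
  exact: measurable_behead.
have consK : cancel (@tuple_cons n) uncons.
  by move=> [x t]; congr pair; apply: val_inj.
exists (fun i => uncons @^-1` (F i `*` G i)) => [|i].
  apply/esym; rewrite -subTset => t _.
  have [i _ Fi] : (\bigcup_i F i) (uncons t).1 by rewrite -FT.
  have [j _ Gj] : (\bigcup_i G i) (uncons t).2 by rewrite -GT.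
  exists (maxn i j) => //; split => /=.
    by move: Fi; apply/subsetPset/ndF/leq_maxl.
  by move: Gj; apply/subsetPset/ndG/leq_maxr.
have [mF Fi] := Foo i; have [mG Gi] := Goo i; split.
  by rewrite -[X in measurable X]setTI; apply: muncons => //; exact: measurableX.
rewrite /lebesgue_cons /pushforward -comp_preimage.
rewrite (_ : uncons \o _ = id); last exact/funext.
by rewrite preimage_id product_measure1E// lte_mul_pinfty// ge0_fin_numE.
Qed.

HB.instance Definition _ := Measure_isSigmaFinite.Build _ _ _ lebesgue_cons
  lebesgue_cons_sigma_finite.

End lebesgue_cons.

Fixpoint lebesgue_tuple n : {sigma_finite_measure set (n.-tuple RR) -> \bar R} :=
  match n with
  | 0 => \d_ [tuple]
  | n'.+1 => lebesgue_cons (lebesgue_tuple n')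
  end.

End lebesgue_tuple.

Section torus.
Variables (R : realType) (d : nat).
Local Notation RR := (measurableTypeR R).
Local Notation Rd := (d.-tuple RR).

Definition torus_eq (x y : Rd) :=
  `[< forall i, exists m : int, tnth x i - tnth y i = m%:~R * (2 * pi) :> R >].

Let torus_eq_refl : reflexive torus_eq.
Proof. by move=> x; apply/asboolP => i; exists 0; rewrite subrr mul0r. Qed.

Let torus_eq_sym : symmetric torus_eq.
Proof.
by move=> x y; apply/idP/idP => /asboolP xy; apply/asboolP => i;
  have [m xym] := xy i; exists (- m); rewrite intrN mulNr -xym opprB.
Qed.

Let torus_eq_trans : transitive torus_eq.
Proof.
move=> y x z /asboolP xy /asboolP yz; apply/asboolP => i.
have [[m xym] [k yzk]] := (xy i, yz i).
by exists (m + k); rewrite intrD mulrDl -xym -yzk subrKA.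
Qed.

Canonical torus_eq_canonical :=
  EquivRel torus_eq torus_eq_refl torus_eq_sym torus_eq_trans.

Definition torus : Type := {eq_quot torus_eq}.
HB.instance Definition _ := Choice.on torus.
HB.instance Definition _ := EqQuotient.on torus.

Definition torus_pi (x : Rd) : torus := \pi_torus x.

HB.instance Definition _ := isPointed.Build torus (torus_pi point).

Definition torus_display : measure_display.
Proof. exact: default_measure_display. Qed.

Definition torus_measurable : set (set torus) :=
  [set A | measurable (torus_pi @^-1` A)].

Let torus_measurable0 : torus_measurable set0.
Proof. by rewrite /torus_measurable/= preimage_set0. Qed.

Let torus_measurableC A : torus_measurable A -> torus_measurable (~` A).
Proof. by rewrite /torus_measurable/= preimage_setC => /measurableC. Qed.

Let torus_measurable_bigcup (F : (set torus)^nat) :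
  (forall i, torus_measurable (F i)) -> torus_measurable (\bigcup_i F i).
Proof.
move=> mF; rewrite /torus_measurable/= preimage_bigcup.
by apply: bigcup_measurable => i _; exact: mF.
Qed.

(* Quotient sigma-algebra; as \pi is a continuous open map which is injective
   on a Borel fundamental domain, this is the Borel sigma-algebra of the
   torus. *)
HB.instance Definition _ := @isMeasurable.Build torus_display torus
  torus_measurable torus_measurable0 torus_measurableC torus_measurable_bigcup.

Lemma measurable_torus_pi : measurable_fun setT torus_pi.
Proof. by move=> _ A mA; rewrite setTI. Qed.

Definition fundamental_cube : set Rd :=
  [set x | forall i, tnth x i \in `[0, 2 * pi[].

Lemma measurable_fundamental_cube : measurable fundamental_cube.
Proof.
rewrite (_ : fundamental_cube =
    \bigcap_(i in [set: 'I_d]) ((@tnth d RR ^~ i) @^-1` `[0, 2 * pi[%classic)).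
  apply: fin_bigcap_measurable => // i _; rewrite -[X in measurable X]setTI.
  by apply: measurable_tnth => //; exact: measurable_itv.
by apply/seteqP; split => [x xc i _|x xc i]; exact: xc.
Qed.

(* dx: the Lebesgue measure of [0, 2 pi)^d, transported to the torus. *)
Definition torus_lebesgue : set torus -> \bar R :=
  pushforward (mrestr (lebesgue_tuple R d) measurable_fundamental_cube) torus_pi.

Let torus_lebesgue0 : torus_lebesgue set0 = 0%E.
Proof. by rewrite /torus_lebesgue /pushforward preimage_set0 measure0. Qed.

Let torus_lebesgue_ge0 A : (0 <= torus_lebesgue A)%E.
Proof. by rewrite /torus_lebesgue /pushforward measure_ge0. Qed.

Let torus_lebesgue_sigma_additive : semi_sigma_additive torus_lebesgue.
Proof.
apply: pushforward_semi_sigma_additive; exact: measurable_torus_pi.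
Qed.

HB.instance Definition _ := isMeasure.Build _ _ _ torus_lebesgue
  torus_lebesgue0 torus_lebesgue_ge0 torus_lebesgue_sigma_additive.

Lemma invXn_2pi_ge0 : 0 <= (2 * pi : R) ^- d.
Proof. by rewrite invr_ge0 exprn_ge0// mulr_ge0// pi_ge0. Qed.

(* (2 pi)^-d dx *)
Definition torus_measure : {measure set torus -> \bar R} :=
  mscale (NngNum invXn_2pi_ge0) torus_lebesgue.

(* Z^d, with the discrete sigma-algebra. *)
Definition frequency : Type := d.-tuple int.
HB.instance Definition _ := Countable.on frequency.
HB.instance Definition _ := isPointed.Build frequency [tuple of nseq d 0].
HB.instance Definition _ := @isMeasurable.Build default_measure_display
  frequency (@discrete_measurable frequency) (@discrete_measurable0 frequency)
  (@discrete_measurableC frequency) (@discrete_measurableU frequency).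

(* exp (i k.x); by 2 pi-periodicity the representative of x does not matter. *)
Definition character (k : frequency) (x : torus) : R[i] :=
  let t : R := \sum_(i < d) (tnth k i)%:~R * tnth (repr x) i in
  cos t +i* sin t.

End torus.

Section able.
Context (R : realType) (d : nat) dX (X : measurableType dX).
Variables (mu : {sigma_finite_measure set X -> \bar R}) (p : torus R d * X -> R).

Definition able_basis (k : frequency d) (y : X) (x : torus R d) : R[i] :=
  (Num.sqrt (p (x, y)))%:C * character k x.

(* When sqrt p(., y) f is not square-integrable, the value is that of the
   total integral and carries no meaning; for f in L2 this concerns a mu-null set of y. *)
Definition able_coef (f : torus R d -> R[i]) (ky : frequency d * X) : R[i] :=
  inner (torus_measure R d) f (able_basis ky.1 ky.2).

Definition frequency_measure : {measure set (frequency d * X) -> \bar R} :=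
  (@counting (frequency d) R \x mu)%E.

(* S(., y) is the L2-sum of sum_k g_{k,y} e^{i k.x} for almost every y, and S is
   jointly measurable, so that S(x, .) can be integrated. *)
Definition is_fourier_sum (g : frequency d * X -> R[i])
    (S : torus R d * X -> R[i]) :=
  cmeasurable S /\
  {ae mu, forall y, L2_has_sum (torus_measure R d)
    (fun k x => g (k, y) * character k x) (fun x => S (x, y))}.

End able.

(* Main.v *)
(* Tonelli and the normalization of p reduce everything to Fourier series on the torus: with
   h_y = f sqrt(p(., y)), the coefficient of f at (k, y) is the k-th Fourier coefficient of h_y,
   and the integral over y of ||h_y||^2 is ||f||^2, so that Parseval for almost every h_y gives
   the isometry.  The L2-sum of the Fourier series of h_y is h_y itself, and integrating
   h_y(x) sqrt(p(x, y)) = f(x) p(x, y) over y recovers f(x).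

   Parseval needs the density of trigonometric polynomials.  The sets whose indicator is an
   L2-limit of trigonometric polynomials form a sigma-algebra, because bounded limits can be
   multiplied.  It contains the arcs {x_i > a}, as the polynomials (1 - t^n)^(n 2^n) tend
   to the indicator of {t < 1/2} on [0, 1] and an arc is described by a strict inequality on a
   cosine of x_i.  Hence it contains all Borel sets. *)

From HB Require Import structures.
Require Import Defs.
From mathcomp Require Import all_boot all_order all_algebra finmap.
From mathcomp Require Import complex ring lra.
From mathcomp Require Import all_classical all_reals all_analysis.
From mathcomp Require Import measurable_realfun.

Set Implicit Arguments.
Unset Strict Implicit.
Unset Printing Implicit Defensive.
Import Order.TTheory GRing.Theory Num.Theory.
Import numFieldNormedType.Exports.
Import ComplexField.Normc.
Local Open Scope classical_set_scope.
Local Open Scope ring_scope.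
Local Open Scope complex_scope.

(** Three difficulties shape the argument. Norms: estimates are made on [sqint], the squared L2-norm
    as an extended real, where the triangle inequality becomes |a + b|^2 <= 2 |a|^2 + 2 |b|^2; hence
    the tolerances r / 4. Null sets: the coefficients determine h_y for almost every y, up to a null
    set of x that depends on y, whereas inversion is read at a fixed x. The two quantifiers are
    exchanged by Tonelli for the squared modulus of a difference, whose double integral vanishes in
    either order. Representatives: an element of the image is known only up to a null set of pairs
    (k, y), and the sum S of its series is any jointly measurable function; both are brought back to
    h_y by uniqueness of L2-sums for almost every y. Injectivity is then a consequence of inversion:
    two functions with almost everywhere equal coefficients share a Fourier sum S, and S determines
    each of them. In Parseval the limit h is known in advance, so density combines directly with the
    best approximation property of Fourier partial sums. *)

Local Notation Re := (@complex.Re _).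
Local Notation Im := (@complex.Im _).


(** * Squared modulus of a complex number *)

Section square_modulus.
Context {R : realType}.
Implicit Types (a b z : R[i]) (r : R).

(** A polynomial in the real and imaginary parts, within reach of [ring] and [nra], where [normc]
    has a square root. *)
Definition sqn z : R := Re z ^+ 2 + Im z ^+ 2.

Lemma normc_sqr z : normc z ^+ 2 = sqn z.
Proof. by case: z => a b /=; rewrite sqr_sqrtr// addr_ge0// sqr_ge0. Qed.

Lemma normc_ge0 z : 0 <= normc z.
Proof. by case: z => a b; exact: sqrtr_ge0. Qed.

Lemma sqn_ge0 z : 0 <= sqn z.
Proof. by rewrite addr_ge0// sqr_ge0. Qed.

Lemma sqn0 : sqn 0 = 0.
Proof. by rewrite /sqn/= expr0n/= addr0. Qed.

Lemma sqn_eq0 z : sqn z = 0 -> z = 0.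
Proof.
case: z => a b; rewrite /sqn/= => /eqP.
by rewrite paddr_eq0 ?sqr_ge0// !sqrf_eq0 => /andP[/eqP-> /eqP->].
Qed.

Lemma sqnM a b : sqn (a * b) = sqn a * sqn b.
Proof. by case: a b => [a b] [c d]; rewrite /sqn/=; ring. Qed.

Lemma sqnN a : sqn (- a) = sqn a.
Proof. by case: a => [a b]; rewrite /sqn/=; ring. Qed.

Lemma sqn_real r : sqn r%:C = r ^+ 2.
Proof. by rewrite /sqn/=; ring. Qed.

Lemma sqnB a b : sqn (a - b) = sqn a - 2 * Re (a * b^*) + sqn b.
Proof. by case: a b => [a b] [c d]; rewrite /sqn/=; ring. Qed.

Lemma sqnE a : sqn a = Re (a * a^*).
Proof. by case: a => [a b]; rewrite /sqn/=; ring. Qed.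

Lemma sqnD_le a b : sqn (a + b) <= 2 * sqn a + 2 * sqn b.
Proof.
case: a b => [a b] [c d]; rewrite /sqn/=.
have := sqr_ge0 (a - c); have := sqr_ge0 (b - d); nra.
Qed.

(** With its companion for [Im], a weak Young inequality: it gives an integrable majorant of f g^*
    for square-integrable f and g. *)
Lemma normcRe_mulJ_le a b : `|Re (a * b^*)| <= sqn a + sqn b.
Proof.
case: a b => [a b] [c d]; rewrite /sqn/=.
have := sqr_ge0 (a - c); have := sqr_ge0 (b - d).
have := sqr_ge0 (a + c); have := sqr_ge0 (b + d).
rewrite ler_norml; nra.
Qed.

Lemma normcIm_mulJ_le a b : `|Im (a * b^*)| <= sqn a + sqn b.
Proof.
case: a b => [a b] [c d]; rewrite /sqn/=.
have := sqr_ge0 (a - d); have := sqr_ge0 (b - c).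
have := sqr_ge0 (a + d); have := sqr_ge0 (b + c).
rewrite ler_norml; nra.
Qed.

Lemma cReD a b : Re (a + b) = Re a + Re b. Proof. by case: a b => [? ?] []. Qed.
Lemma cImD a b : Im (a + b) = Im a + Im b. Proof. by case: a b => [? ?] []. Qed.
Lemma cReM a b : Re (a * b) = Re a * Re b - Im a * Im b.
Proof. by case: a b => [? ?] []. Qed.
Lemma cImM a b : Im (a * b) = Re a * Im b + Im a * Re b.
Proof. by case: a b => [? ?] [] *. Qed.
Lemma cReJ a : Re a^* = Re a. Proof. by case: a. Qed.
Lemma cImJ a : Im a^* = - Im a. Proof. by case: a. Qed.

Lemma eqRI a b : Re a = Re b -> Im a = Im b -> a = b.
Proof. by case: a b => [? ?] [? ?] /= -> ->. Qed.

End square_modulus.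

(** * Measurability of complex-valued functions *)

Section complex_measurable.
Context {R : realType} {d : measure_display} {T : measurableType d}.
Implicit Types f g : T -> R[i].

Lemma cmeasurable_cst c : cmeasurable (fun=> c : R[i]) (T := T).
Proof. by split; exact: measurable_cst. Qed.

Lemma cmeasurableD f g : cmeasurable f -> cmeasurable g ->
  cmeasurable (fun x => f x + g x).
Proof.
move=> [f1 f2] [g1 g2]; split.
  by under [X in measurable_fun _ X]eq_fun do rewrite /= cReD; exact: measurable_funD.
by under [X in measurable_fun _ X]eq_fun do rewrite /= cImD; exact: measurable_funD.
Qed.

Lemma cmeasurableM f g : cmeasurable f -> cmeasurable g ->
  cmeasurable (fun x => f x * g x).
Proof.
move=> [f1 f2] [g1 g2]; split.
  under [X in measurable_fun _ X]eq_fun do rewrite /= cReM.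
  by apply: measurable_funB; exact: measurable_funM.
under [X in measurable_fun _ X]eq_fun do rewrite /= cImM.
by apply: measurable_funD; exact: measurable_funM.
Qed.

Lemma cmeasurableJ f : cmeasurable f -> cmeasurable (fun x => (f x)^*).
Proof.
move=> [f1 f2]; split.
  by under [X in measurable_fun _ X]eq_fun do rewrite /= cReJ.
under [X in measurable_fun _ X]eq_fun do rewrite /= cImJ.
exact: measurableT_comp.
Qed.

Lemma cmeasurableN f : cmeasurable f -> cmeasurable (fun x => - f x).
Proof.
move=> mf; under [X in cmeasurable X]eq_fun do rewrite -mulN1r.
by apply: cmeasurableM => //; exact: cmeasurable_cst.
Qed.

Lemma cmeasurableB f g : cmeasurable f -> cmeasurable g ->
  cmeasurable (fun x => f x - g x).
Proof. by move=> mf mg; apply: cmeasurableD => //; exact: cmeasurableN. Qed.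

Lemma cmeasurable_real (u : T -> R) :
  measurable_fun setT u -> cmeasurable (fun x => (u x)%:C).
Proof. by move=> mu; split => //; exact: measurable_cst. Qed.

Lemma cmeasurable_sum (I : Type) (s : seq I) (f : I -> T -> R[i]) :
  (forall i, cmeasurable (f i)) -> cmeasurable (fun x => \sum_(i <- s) f i x).
Proof.
move=> mf; elim: s => [|i s ih].
  by under [X in cmeasurable X]eq_fun do rewrite big_nil; exact: cmeasurable_cst.
under [X in cmeasurable X]eq_fun do rewrite big_cons.
exact: cmeasurableD.
Qed.

Lemma cmeasurable_comp {d'} {T' : measurableType d'} (h : T' -> T) f :
  measurable_fun setT h -> cmeasurable f -> cmeasurable (fun x => f (h x)).
Proof.
move=> mh [f1 f2]; split.
  exact: (measurableT_comp f1 mh).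
exact: (measurableT_comp f2 mh).
Qed.

Lemma measurable_sqn f : cmeasurable f -> measurable_fun setT (fun x => sqn (f x)).
Proof. by move=> [f1 f2]; apply: measurable_funD; exact: measurable_funX. Qed.

End complex_measurable.

(** * The squared L2-norm *)

Section square_integral.
Context {R : realType} {d : measure_display} {T : measurableType d}.
Variable mu : {measure set T -> \bar R}.
Implicit Types f g : T -> R[i].

(** All L2 estimates are made on this quantity; [L2norm_sqr], [L2norm_ltP] and [square_integrableP]
    translate to and from the norm of the statement. *)
Definition sqint f : \bar R := (\int[mu]_x (sqn (f x))%:E)%E.

Lemma sqint_ge0 f : (0 <= sqint f)%E.
Proof. by apply: integral_ge0 => x _; rewrite lee_fin sqn_ge0. Qed.

Lemma L2norm_sqr f : (L2norm mu f ^+ 2 = sqint f)%E.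
Proof.
have poweR2 (x : \bar R) : (0 <= x -> x ^+ 2 = x `^ 2)%E.
  case: x => [r| |] r0; last by [].
    by rewrite poweR_EFin powR_mulrn ?EFin_expe.
  by rewrite poweRyr ?pnatr_eq0// expe2 mulyy.
rewrite poweR2; last exact: Lnorm_ge0.
rewrite /L2norm powR_Lnorm//; apply: eq_integral => x _ /=.
by rewrite ger0_norm ?normc_ge0// powR_mulrn ?normc_ge0// normc_sqr.
Qed.

Lemma L2norm_ltP f (e : R) : 0 < e ->
  (L2norm mu f < e%:E)%E <-> (sqint f < (e ^+ 2)%:E)%E.
Proof.
move=> e0; rewrite -L2norm_sqr EFin_expe.
have : (0 <= L2norm mu f)%E by exact: Lnorm_ge0.
case: (L2norm mu f) => [r| |] r0; last by [].
  by rewrite -!EFin_expe !lte_fin ltr_pXn2r ?nnegrE// ltW.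
by rewrite -EFin_expe expe2 mulyy.
Qed.

Lemma square_integrableP f :
  square_integrable mu f <-> cmeasurable f /\ (sqint f < +oo)%E.
Proof.
rewrite /square_integrable /finite_norm -/(L2norm mu f) -L2norm_sqr.
have : (0 <= L2norm mu f)%E by exact: Lnorm_ge0.
case: (L2norm mu f) => [r| |] r0; last by [].
  by rewrite -EFin_expe !ltry.
by rewrite expe2 mulyy.
Qed.

End square_integral.

(** * Complex integrals, inner products and L2 estimates *)

Section complex_integral.
Context {R : realType} {d : measure_display} {T : measurableType d}.
Variable mu : {measure set T -> \bar R}.
Implicit Types f g : T -> R[i].

Lemma integrable_ext (u v : T -> \bar R) : mu.-integrable setT u ->
  u =1 v -> mu.-integrable setT v.
Proof. by move=> iu /funext <-. Qed.

Lemma integrable_ae_eq (u v : T -> \bar R) : mu.-integrable setT u ->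
  measurable_fun setT v -> {ae mu, forall x, u x = v x} -> mu.-integrable setT v.
Proof.
move=> /integrableP[mu_ uoo] mv uv; apply/integrableP; split => //.
apply: le_lt_trans uoo; rewrite le_eqVlt; apply/orP; left; apply/eqP.
apply: ge0_ae_eq_integral => //; [exact: measurableT_comp|exact: measurableT_comp|].
by apply: filterS uv => x -> _.
Qed.

Lemma cintegrable_cmeasurable f : cintegrable mu f -> cmeasurable f.
Proof.
by move=> [/integrableP[/measurable_EFinP ? _] /integrableP[/measurable_EFinP ? _]].
Qed.

Lemma cintegralD f g : cintegrable mu f -> cintegrable mu g ->
  cintegral mu (fun x => f x + g x) = cintegral mu f + cintegral mu g.
Proof.
move=> [f1 f2] [g1 g2]; apply: eqRI => /=; rewrite ?cReD ?cImD/=.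
  by rewrite -RintegralD//; apply: eq_Rintegral => x _ /=; rewrite cReD.
by rewrite -RintegralD//; apply: eq_Rintegral => x _ /=; rewrite cImD.
Qed.

Lemma cintegrableZ c f : cintegrable mu f -> cintegrable mu (fun x => c * f x).
Proof.
move=> [f1 f2]; split.
  have i1 := integrableZl measurableT (Re c) f1.
  have i2 := integrableZl measurableT (Im c) f2.
  apply: (integrable_ext (integrableB measurableT i1 i2)) => x /=.
  by rewrite cReM EFinB !EFinM.
have i1 := integrableZl measurableT (Re c) f2.
have i2 := integrableZl measurableT (Im c) f1.
apply: (integrable_ext (integrableD measurableT i1 i2)) => x /=.
by rewrite cImM EFinD !EFinM.
Qed.

Lemma integrable_Z (r : R) (u : T -> R) : mu.-integrable setT (EFin \o u) ->
  mu.-integrable setT (EFin \o (fun x => r * u x)).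
Proof.
move=> /(integrableZl measurableT r).
by move/integrable_ext; apply => x /=; rewrite EFinM.
Qed.

Lemma cintegralZ c f : cintegrable mu f ->
  cintegral mu (fun x => c * f x) = c * cintegral mu f.
Proof.
move=> [f1 f2]; apply: eqRI => /=; rewrite ?cReM ?cImM/=.
  rewrite -!RintegralZl// -RintegralB//; [|exact: integrable_Z..].
  by apply: eq_Rintegral => x _ /=; rewrite cReM.
rewrite -!RintegralZl// -RintegralD//; [|exact: integrable_Z..].
by apply: eq_Rintegral => x _ /=; rewrite cImM.
Qed.

Lemma cintegral_ae_eq f g : cmeasurable f -> cmeasurable g ->
  {ae mu, forall x, f x = g x} -> cintegral mu f = cintegral mu g.
Proof.
move=> [f1 f2] [g1 g2] fg; rewrite /cintegral /Rintegral; congr (fine _ +i* fine _).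
  apply: ae_eq_integral => //; [exact/measurable_EFinP..|].
  by apply: filterS fg => x /= -> _.
apply: ae_eq_integral => //; [exact/measurable_EFinP..|].
by apply: filterS fg => x /= -> _.
Qed.

Lemma sqint_integrable f : square_integrable mu f ->
  mu.-integrable setT (EFin \o (fun x => sqn (f x))).
Proof.
move=> /square_integrableP[mf foo]; apply/integrableP; split.
  exact/measurable_EFinP/measurable_sqn.
apply: le_lt_trans foo; apply: ge0_le_integral => //=.
- by apply/measurable_EFinP; apply: measurableT_comp => //; exact: measurable_sqn.
- by apply/measurable_EFinP; exact: measurable_sqn.
- by move=> x _; rewrite lee_fin ger0_norm ?sqn_ge0.
Qed.

Lemma cintegrable_mulJ f g : square_integrable mu f -> square_integrable mu g ->
  cintegrable mu (fun x => f x * (g x)^*).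
Proof.
move=> hf hg.
have ifg := integrableD measurableT
  (sqint_integrable hf) (sqint_integrable hg).
have [m1 m2] : cmeasurable (fun x => f x * (g x)^*).
  by apply: cmeasurableM; [case: hf|apply: cmeasurableJ; case: hg].
split; (apply: (le_integrable _ _ _ ifg) => //; first exact/measurable_EFinP).
  by move=> x _ /=; rewrite lee_fin (ger0_norm (addr_ge0 (sqn_ge0 _) (sqn_ge0 _))) normcRe_mulJ_le.
by move=> x _ /=; rewrite lee_fin (ger0_norm (addr_ge0 (sqn_ge0 _) (sqn_ge0 _))) normcIm_mulJ_le.
Qed.

Lemma measurable_EFin_sqn f : cmeasurable f ->
  measurable_fun setT (fun x => (sqn (f x))%:E).
Proof. by move=> mf; exact/measurable_EFinP/measurable_sqn. Qed.

(** Plays the part of the triangle inequality; the factors 2 are the price of working with squared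
    norms. *)
Lemma sqintD_le f g : cmeasurable f -> cmeasurable g ->
  (sqint mu (fun x => f x + g x)%R <= 2%:E * sqint mu f + 2%:E * sqint mu g)%E.
Proof.
move=> mf mg.
have sq0 (h : T -> R[i]) x : (0 <= (sqn (h x))%:E)%E by rewrite lee_fin sqn_ge0.
have msf := measurable_EFin_sqn mf; have msg := measurable_EFin_sqn mg.
rewrite -!ge0_integralZl//.
rewrite -ge0_integralD//; [|by move=> x _; rewrite mule_ge0|exact: measurable_funeM
  |by move=> x _; rewrite mule_ge0|exact: measurable_funeM].
apply: ge0_le_integral => //.
- by move=> x _; rewrite lee_fin sqn_ge0.
- by apply: measurable_EFin_sqn; exact: cmeasurableD.
- by apply: emeasurable_funD; exact: measurable_funeM.
- by move=> x _; rewrite -!EFinM -EFinD lee_fin sqnD_le.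
Qed.

Lemma sqintB_le f g h : cmeasurable f -> cmeasurable g -> cmeasurable h ->
  (sqint mu (fun x => f x - h x)%R <=
   2%:E * sqint mu (fun x => f x - g x)%R + 2%:E * sqint mu (fun x => g x - h x)%R)%E.
Proof.
move=> mf mg mh; rewrite (_ : (fun x => f x - h x) = fun x => f x - g x + (g x - h x)).
  by apply: sqintD_le; exact: cmeasurableB.
by apply/funext => x; rewrite addrA subrK.
Qed.

Lemma sqintN f : sqint mu (fun x => - f x) = sqint mu f.
Proof. by apply: eq_integral => x _; rewrite sqnN. Qed.

Lemma square_integrableD f g : square_integrable mu f -> square_integrable mu g ->
  square_integrable mu (fun x => f x + g x).
Proof.
move=> /square_integrableP[mf foo] /square_integrableP[mg goo].
apply/square_integrableP; split; first exact: cmeasurableD.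
by apply: le_lt_trans (sqintD_le mf mg) _; rewrite lte_add_pinfty// lte_mul_pinfty.
Qed.

Lemma square_integrableZ c f : square_integrable mu f ->
  square_integrable mu (fun x => c * f x).
Proof.
move=> hf; have [mf _] := hf; apply/square_integrableP; split.
  by apply: cmeasurableM => //; exact: cmeasurable_cst.
have /integrableP[_] := integrable_Z (sqn c) (sqint_integrable hf).
apply: le_lt_trans; apply: ge0_le_integral => //=.
- by move=> x _; rewrite lee_fin sqn_ge0.
- by apply/measurable_EFinP/measurable_sqn; apply: cmeasurableM => //; exact: cmeasurable_cst.
- by apply/measurable_EFinP; apply: measurableT_comp => //;
    apply: measurable_funM => //; exact: measurable_sqn.
- by move=> x _; rewrite lee_fin sqnM ler_norm.
Qed.

Lemma square_integrableB f g : square_integrable mu f -> square_integrable mu g ->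
  square_integrable mu (fun x => f x - g x).
Proof.
move=> hf hg; under eq_fun do rewrite -mulN1r.
by apply: square_integrableD => //; exact: square_integrableZ.
Qed.

Lemma square_integrable0 : square_integrable mu (fun=> 0).
Proof.
apply/square_integrableP; split; first exact: cmeasurable_cst.
by rewrite /sqint; under eq_integral do rewrite sqn0; rewrite integral0 ltry.
Qed.

Lemma square_integrable_sum (I : Type) (s : seq I) (f : I -> T -> R[i]) :
  (forall i, square_integrable mu (f i)) ->
  square_integrable mu (fun x => \sum_(i <- s) f i x).
Proof.
move=> hf; elim: s => [|i s ih].
  by under eq_fun do rewrite big_nil; exact: square_integrable0.
under eq_fun do rewrite big_cons; exact: square_integrableD.
Qed.

Lemma inner_sub_scale f g h c : square_integrable mu f -> square_integrable mu g ->
  square_integrable mu h ->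
  inner mu (fun x => f x - c * g x) h = inner mu f h - c * inner mu g h.
Proof.
move=> hf hg hh; rewrite -mulNr /inner -cintegralZ; last exact: cintegrable_mulJ.
rewrite -cintegralD; [|exact: cintegrable_mulJ|exact/cintegrableZ/cintegrable_mulJ].
by congr cintegral; apply/funext => x; rewrite -mulNr mulrDl mulrA.
Qed.

Lemma sqint_fin_num f : square_integrable mu f -> sqint mu f \is a fin_num.
Proof.
by move=> /square_integrableP[_ foo]; rewrite ge0_fin_numE// sqint_ge0.
Qed.

(** The expansion of a squared distance, which is one step of the induction in
    [bessel_identity_seq]. Both [sqint] of f and of g are finite, so [fine] loses nothing. *)
Lemma sqint_sub_scale f g c : square_integrable mu f -> square_integrable mu g ->
  fine (sqint mu (fun x => f x - c * g x)) =
  fine (sqint mu f) - 2 * Re (c^* * inner mu f g) + sqn c * fine (sqint mu g).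
Proof.
move=> hf hg.
have ifg := cintegrable_mulJ hf hg.
have [iRe _] := cintegrableZ c^* ifg.
rewrite /inner -cintegralZ//= -!RintegralZl//; last exact: sqint_integrable.
rewrite -RintegralB//; [|exact: sqint_integrable|exact: integrable_Z].
rewrite -RintegralD//.
- by apply: eq_Rintegral => x _ /=; rewrite sqnB sqnM rmorphM/= mulrCA.
- exact: (integrable_ext (integrableB measurableT
    (sqint_integrable hf) (integrable_Z 2 iRe))).
- by apply: integrable_Z; exact: sqint_integrable.
Qed.

Lemma sqint_eq0 f : cmeasurable f -> sqint mu f = 0%E -> {ae mu, forall x, f x = 0}.
Proof.
move=> mf f0; have /ae_eq_integral_abs : measurable_fun setT (fun x => (sqn (f x))%:E).
  exact/measurable_EFinP/measurable_sqn.
move=> /(_ mu measurableT)[+ _]; rewrite /=.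
under eq_integral do rewrite ger0_norm ?sqn_ge0//.
move=> /(_ f0); apply: filterS => x /(_ I)[]; exact: sqn_eq0.
Qed.

Lemma sqint_ae_eq f g : cmeasurable f -> cmeasurable g ->
  {ae mu, forall x, f x = g x} -> sqint mu f = sqint mu g.
Proof.
move=> mf mg fg; apply: ae_eq_integral => //;
  [exact/measurable_EFinP/measurable_sqn..|].
by apply: filterS fg => x /= -> _.
Qed.

End complex_integral.

(** * Orthonormal families: Bessel, best approximation, Parseval *)

Section orthonormal.
Context {R : realType} {d : measure_display} {T : measurableType d}.
Variable mu : {measure set T -> \bar R}.
Context {I : choiceType}.
Variable e : I -> T -> R[i].
Hypothesis e_sq : forall i, square_integrable mu (e i).
Hypothesis e_orth : forall i j, inner mu (e i) (e j) = (i == j)%:R.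
Implicit Types (h : T -> R[i]) (b : I -> R[i]) (A : {fset I}).

(** Completing the square in each coefficient. The induction varies h: removing b_i e_i from h
    leaves the coefficients at all j <> i unchanged by orthonormality, and [uniq s] keeps i out of
    the tail. *)
Lemma bessel_identity_seq h b (s : seq I) : square_integrable mu h -> uniq s ->
  fine (sqint mu (fun x => h x - \sum_(i <- s) b i * e i x)) =
  fine (sqint mu h) - \sum_(i <- s) sqn (inner mu h (e i))
    + \sum_(i <- s) sqn (b i - inner mu h (e i)).
Proof.
elim: s h => [h _ _|i s ih h hh /= /andP[is_ us]].
  rewrite !big_nil subr0 addr0; congr (fine (sqint _ _)).
  by apply/funext => x; rewrite big_nil subr0.
have hbe : square_integrable mu (fun x => h x - b i * e i x).
  by apply: square_integrableB => //; exact: square_integrableZ.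
under eq_fun do rewrite big_cons opprD addrA.
rewrite ih// sqint_sub_scale// !big_cons.
have -> : fine (sqint mu (e i)) = 1.
  transitivity (Re (inner mu (e i) (e i))); last by rewrite e_orth eqxx.
  by apply: eq_Rintegral => x _ /=; rewrite -sqnE.
have inn j : j \in s -> inner mu (fun x => h x - b i * e i x) (e j) = inner mu h (e j).
  move=> js; rewrite inner_sub_scale// e_orth.
  by case: eqP js is_ => [-> ->//|_ _ _]; rewrite mulr0 subr0.
rewrite (eq_big_seq (fun j => sqn (inner mu h (e j)))); last by move=> j /inn ->.
rewrite [X in _ + X = _](eq_big_seq (fun j => sqn (b j - inner mu h (e j)))); last first.
  by move=> j /inn ->.
rewrite mulr1.
have -> : sqn (b i - inner mu h (e i)) = sqn (b i) -
    2 * Re ((b i)^* * inner mu h (e i)) + sqn (inner mu h (e i)).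
  by rewrite sqnB; case: (b i) (inner mu h (e i)) => [? ?] [? ?] /=; ring.
ring.
Qed.

Lemma bessel_identity h A : square_integrable mu h ->
  fine (sqint mu (fun x => h x - \sum_(i <- A) inner mu h (e i) * e i x)) =
  fine (sqint mu h) - \sum_(i <- A) sqn (inner mu h (e i)).
Proof.
move=> hh; rewrite bessel_identity_seq ?fset_uniq// [X in _ + X]big1 ?addr0//.
by move=> i _; rewrite subrr sqn0.
Qed.

Lemma fourier_best_approximation h b A : square_integrable mu h ->
  fine (sqint mu (fun x => h x - \sum_(i <- A) inner mu h (e i) * e i x)) <=
  fine (sqint mu (fun x => h x - \sum_(i <- A) b i * e i x)).
Proof.
move=> hh; rewrite bessel_identity// bessel_identity_seq ?fset_uniq// lerDl.
by apply: sumr_ge0 => i _; exact: sqn_ge0.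
Qed.

(** Density of the linear span, in the shape of the net of finite sets used by [L2_has_sum]: a
    combination over A0 is one over each larger A, with zero coefficients added. *)
Hypothesis e_total : forall h (r : R), square_integrable mu h -> 0 < r ->
  exists A0 : {fset I}, forall A, (A0 `<=` A)%fset ->
  exists b, (sqint mu (fun x => h x - \sum_(i <- A) b i * e i x)%R < r%:E)%E.

Lemma square_integrable_partial_sum b A :
  square_integrable mu (fun x => \sum_(i <- A) b i * e i x).
Proof. by apply: square_integrable_sum => i; exact: square_integrableZ. Qed.

Lemma fourier_remainder_small h (r : R) : square_integrable mu h -> 0 < r ->
  exists A0 : {fset I}, forall A, (A0 `<=` A)%fset ->
  fine (sqint mu (fun x => h x - \sum_(i <- A) inner mu h (e i) * e i x)) < r.
Proof.
move=> hh r0; have [A0 hA0] := e_total hh r0; exists A0 => A /hA0[b hb].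
apply: le_lt_trans (fourier_best_approximation b A hh) _.
rewrite -lte_fin fineK//; apply: sqint_fin_num; apply: square_integrableB => //.
exact: square_integrable_partial_sum.
Qed.

Lemma fourier_has_sum h : square_integrable mu h ->
  L2_has_sum mu (fun i x => inner mu h (e i) * e i x) h.
Proof.
move=> hh; split => // r r0.
have [A0 hA0] := fourier_remainder_small hh (exprn_gt0 2 r0); exists A0 => A /hA0.
set S := fun x => _ - _ => small; apply/L2norm_ltP => //.
rewrite [X in sqint _ X](_ : _ = fun x => - S x); last first.
  by apply/funext => x; rewrite /S opprB.
rewrite /sqint; under eq_integral do rewrite sqnN.
rewrite -/(sqint mu S) -[sqint mu S]fineK ?lte_fin//; apply: sqint_fin_num.
by apply: square_integrableB => //; exact: square_integrable_partial_sum.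
Qed.

(** The left-hand side is a supremum over finite sets. Each finite sum is bounded by Bessel, the
    remainder being nonnegative; a finite set with remainder below r gives the converse up to r. *)
Lemma parseval h : square_integrable mu h ->
  (\esum_(i in [set: I]) (sqn (inner mu h (e i)))%:E = sqint mu h)%E.
Proof.
move=> hh; apply/eqP; rewrite eq_le; apply/andP; split.
  apply: ge_ereal_sup => _ [A [finA _] <-].
  rewrite fsbig_finite//= sumEFin -[leRHS]fineK ?sqint_fin_num// lee_fin.
  rewrite -subr_ge0 -bessel_identity//.
  by apply: fine_ge0; exact: sqint_ge0.
apply/lee_addgt0Pr => r r0.
have [A0 /(_ A0 (fsubset_refl _))] := fourier_remainder_small hh r0.
rewrite bessel_identity// ltrBlDr => /ltW hA.
rewrite -[leLHS]fineK ?sqint_fin_num//.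
apply: (@le_trans _ _ (r + \sum_(i <- A0) sqn (inner mu h (e i)))%:E).
  by rewrite lee_fin.
rewrite EFinD addeC leeD2r// -sumEFin; apply: ereal_sup_ubound.
exists [set` A0]; first by split => //; exact: finite_fset.
by rewrite fsbig_finite//= set_fsetK.
Qed.

End orthonormal.

Lemma L2_has_sum_unique {R : realType} {d} {T : measurableType d}
    (mu : {measure set T -> \bar R}) {I : choiceType} (u : I -> T -> R[i])
    (s s' : T -> R[i]) : (forall i, cmeasurable (u i)) ->
  L2_has_sum mu u s -> L2_has_sum mu u s' -> {ae mu, forall x, s x = s' x}.
Proof.
move=> mu_ [[ms foo] hs] [[ms' foo'] hs'].
have mss' : cmeasurable (fun x => s x - s' x) by exact: cmeasurableB.
suff s0 : sqint mu (fun x => s x - s' x) = 0%E.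
  by apply: filterS (sqint_eq0 mss' s0) => x /eqP; rewrite subr_eq0 => /eqP.
apply/eqP; rewrite eq_le sqint_ge0 andbT; apply/lee_addgt0Pr => r r0; rewrite add0e.
(* Both sums lie within q of the partial sum over the union of A0 and A1, and 2 q^2 + 2 q^2 = r. *)
pose q := Num.sqrt (r / 4).
have q0 : 0 < q by rewrite sqrtr_gt0 divr_gt0.
have [A0 hA0] := hs q q0; have [A1 hA1] := hs' q q0.
have := hA0 _ (fsubsetUl A0 A1); have := hA1 _ (fsubsetUr A0 A1).
pose S x := \sum_(i <- (A0 `|` A1)%fset) u i x.
move=> /(L2norm_ltP _ _ q0) l1 /(L2norm_ltP _ _ q0) l2.
have mS : cmeasurable S by exact: cmeasurable_sum.
apply: le_trans (sqintB_le mu ms mS ms') _.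
rewrite -[X in (2%:E * X + _)%E]sqintN; under eq_fun do rewrite opprB.
have -> : r%:E = (2%:E * (q ^+ 2)%:E + 2%:E * (q ^+ 2)%:E)%E.
  by rewrite -!EFinM -EFinD sqr_sqrtr ?divr_ge0 ?ltW//; congr EFin; field.
by rewrite leeD// lee_wpmul2l ?lee_fin// ltW.
Qed.

(** * Periodicity of cosine and sine under integer multiples of 2 pi *)

Section periodicity.
Context {R : realType}.
Implicit Types (x : R) (m : int).

Lemma cosD2piz m x : cos (x + m%:~R * (2 * pi)) = cos x.
Proof.
have per (n : nat) y : cos (y + n%:R * (2 * pi)) = cos y :> R.
  by rewrite -[RHS](periodicn (@cosD2pi R) n) -[X in _ = cos (_ + X)]mulr_natl (mulr_natl pi 2).
case: m => n; first exact: per.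
by rewrite NegzE mulrNz mulNr -[LHS](per n.+1) subrK.
Qed.

Lemma sinD2piz m x : sin (x + m%:~R * (2 * pi)) = sin x.
Proof. by rewrite -!cosBpihalf addrAC cosD2piz. Qed.

End periodicity.

(** * Integrals of cosine and sine over one period *)

Section one_dimensional_integrals.
Context {R : realType}.
Notation leb := (@lebesgue_measure R).

Lemma continuous_cosZ (k : R) : continuous (fun t : R => cos (k * t)).
Proof.
move=> t; apply: continuous_comp; last exact: continuous_cos.
exact: mulrl_continuous.
Qed.

Lemma continuous_sinZ (k : R) : continuous (fun t : R => sin (k * t)).
Proof.
move=> t; apply: continuous_comp; last exact: continuous_sin.
exact: mulrl_continuous.
Qed.

Lemma measurable_cosZ (k : R) : measurable_fun setT (fun t : R => cos (k * t)).
Proof. by apply: continuous_measurable_fun; exact: continuous_cosZ. Qed.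

Lemma measurable_sinZ (k : R) : measurable_fun setT (fun t : R => sin (k * t)).
Proof. by apply: continuous_measurable_fun; exact: continuous_sinZ. Qed.

Lemma integral_cosz (m : int) :
  (\int[leb]_(t in `[0%R, (2 * pi)%R[) (cos (m%:~R * t))%:E)%E =
  (((m == 0)%:R * (2 * pi))%:E).
Proof.
have pi0 : 0 < 2 * pi :> R by rewrite mulr_gt0// pi_gt0.
have [->|m0] := eqVneq m 0.
  under eq_integral do rewrite mul0r cos0.
  rewrite integral_cst//= lebesgue_measure_itv/= lte_fin pi0 mul1e mul1r.
  by rewrite oppr0 adde0.
(* The endpoint 2 pi is a null set; the fundamental theorem of calculus is applied on the closed
   interval. *)
rewrite integral_itv_bndo_bndc; last first.
  apply/measurable_EFinP/measurable_funTS; exact: measurable_cosZ.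
have mR0 : m%:~R != 0 :> R by rewrite intr_eq0.
have dF (x : R) : is_derive x (1 : R) (fun t : R => m%:~R^-1 * sin (m%:~R * t)) (cos (m%:~R * x)).
  apply: is_derive_eq.
  by rewrite /GRing.scale/=; field.
rewrite (@continuous_FTC2 _ _ (fun t : R => m%:~R^-1 * sin (m%:~R * t)))//.
- have -> : sin (m%:~R * (2 * pi)) = 0 :> R.
    by rewrite -[X in sin X]add0r sinD2piz sin0.
  by rewrite !mulr0 sin0 mulr0 mul0r -EFinB subr0.
- by apply: continuous_subspaceT; exact: continuous_cosZ.
- have cF : continuous (fun t : R => m%:~R^-1 * sin (m%:~R * t)).
    move=> t; apply: differentiable_continuous; apply/derivable1_diffP.
    by apply: ex_derive; exact: dF.
  split.
  + by move=> x _; apply: ex_derive; exact: dF.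
  + by apply: cvg_at_right_filter; exact: cF.
  + by apply: cvg_at_left_filter; exact: cF.
- by move=> x _; rewrite derive1E; apply: derive_val.
Qed.

Lemma integral_sinz (m : int) :
  (\int[leb]_(t in `[0%R, (2 * pi)%R[) (sin (m%:~R * t))%:E = 0)%E.
Proof.
have pi0 : 0 < 2 * pi :> R by rewrite mulr_gt0// pi_gt0.
have [->|m0] := eqVneq m 0.
  by under eq_integral do rewrite mul0r sin0; rewrite integral0.
rewrite integral_itv_bndo_bndc; last first.
  apply/measurable_EFinP/measurable_funTS; exact: measurable_sinZ.
have mR0 : m%:~R != 0 :> R by rewrite intr_eq0.
have dF (x : R) : is_derive x (1 : R) (fun t : R => - m%:~R^-1 * cos (m%:~R * t)) (sin (m%:~R * x)).
  apply: is_derive_eq.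
  by rewrite /GRing.scale/=; field.
rewrite (@continuous_FTC2 _ _ (fun t : R => - m%:~R^-1 * cos (m%:~R * t)))//.
- have -> : cos (m%:~R * (2 * pi)) = 1 :> R.
    by rewrite -[X in cos X]add0r cosD2piz cos0.
  by rewrite mulr0 cos0 subee.
- by apply: continuous_subspaceT; exact: continuous_sinZ.
- have cF : continuous (fun t : R => - m%:~R^-1 * cos (m%:~R * t)).
    move=> t; apply: differentiable_continuous; apply/derivable1_diffP.
    by apply: ex_derive; exact: dF.
  split.
  + by move=> x _; apply: ex_derive; exact: dF.
  + by apply: cvg_at_right_filter; exact: cF.
  + by apply: cvg_at_left_filter; exact: cF.
- by move=> x _; rewrite derive1E; apply: derive_val.
Qed.

End one_dimensional_integrals.

(** * Integrals of characters over the cube *)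

Section phases.
Context {R : realType}.
Notation RR := (measurableTypeR R).
Notation leb := (@lebesgue_measure R).

(** The sum inside [character], taken at an arbitrary tuple instead of the representative chosen by
    [repr]. *)
Definition phase n (k : n.-tuple int) (x : n.-tuple RR) : R :=
  \sum_(i < n) (tnth k i)%:~R * tnth x i.

Lemma measurable_phase n (k : n.-tuple int) : measurable_fun setT (phase k).
Proof.
apply: measurable_sum => i; apply: measurable_funM => //.
exact: measurable_tnth.
Qed.

Lemma measurable_cos_phase n (k : n.-tuple int) :
  measurable_fun setT (fun x => cos (phase k x)).
Proof.
apply: measurableT_comp (measurable_phase k).
by apply: continuous_measurable_fun; exact: continuous_cos.
Qed.

Lemma measurable_sin_phase n (k : n.-tuple int) :
  measurable_fun setT (fun x => sin (phase k x)).
Proof.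
apply: measurableT_comp (measurable_phase k).
by apply: continuous_measurable_fun; exact: continuous_sin.
Qed.

Lemma phase_cons n (k : n.+1.-tuple int) (t : RR) (x : n.-tuple RR) :
  phase k (tuple_cons (t, x)) =
  (thead k)%:~R * t + phase [tuple of behead k] x.
Proof.
rewrite /phase big_ord_recl; congr (_ + _).
by apply: eq_bigr => i _; rewrite {1}(tuple_eta k) /tuple_cons !tnthS.
Qed.

Lemma preimage_cube_cons n :
  @tuple_cons R n @^-1` @fundamental_cube R n.+1 =
  `[0, 2 * pi[%classic `*` @fundamental_cube R n.
Proof.
apply/seteqP; split => [[t x] /= h|[t x] [/= ht hx] i].
  split => [|i]; first exact: (h ord0).
  by have := h (lift ord0 i); rewrite /tuple_cons tnthS.
by case: (unliftP ord0 i) => [j ->|->//]; rewrite /tuple_cons tnthS.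
Qed.

Let twopi_gt0 : 0 < 2 * pi :> R.
Proof. by rewrite mulr_gt0// pi_gt0. Qed.

Lemma lebesgue_cube n :
  lebesgue_tuple R n (@fundamental_cube R n) = ((2 * pi) ^+ n)%:E.
Proof.
elim: n => [|n ih].
  by rewrite /= expr0 diracE mem_set// => -[].
rewrite /= /lebesgue_cons /pushforward preimage_cube_cons product_measure1E//=.
  by rewrite ih lebesgue_measure_itv/= lte_fin twopi_gt0 oppr0 adde0 -EFinM exprS.
exact: measurable_fundamental_cube.
Qed.

Lemma integrable_cube n (u : n.-tuple RR -> R) : measurable_fun setT u ->
  (forall x, `|u x| <= 1) ->
  (lebesgue_tuple R n).-integrable (@fundamental_cube R n) (EFin \o u).
Proof.
move=> mu u1; apply: measurable_bounded_integrable.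
- exact: measurable_fundamental_cube.
- by apply: le_lt_trans (ltry ((2 * pi) ^+ n)); rewrite -lebesgue_cube.
- exact: measurable_funTS.
- by exists 1; split => // M M1 x _ /=; rewrite (le_trans (u1 x))// ltW.
Qed.

Lemma integrable_itv2pi (u : R -> R) : measurable_fun setT u ->
  (forall x, `|u x| <= 1) -> leb.-integrable `[0, 2 * pi[ (EFin \o u).
Proof.
move=> mu u1; apply: measurable_bounded_integrable => //.
- have leb2pi : leb `[0, 2 * pi[%classic = (2 * pi)%:E.
    by rewrite lebesgue_measure_itv/= lte_fin twopi_gt0 oppr0 adde0.
  by apply: le_lt_trans (ltry (2 * pi)); rewrite -leb2pi.
- exact: measurable_funTS.
- by exists 1; split => // M M1 x _ /=; rewrite (le_trans (u1 x))// ltW.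
Qed.

(** Fubini in the first coordinate. As u is signed, integrability is obtained from its bound and the
    finite measure of the cube. *)
Lemma integral_cube_cons n (u : n.+1.-tuple RR -> R) : measurable_fun setT u ->
  (forall x, `|u x| <= 1) ->
  (\int[lebesgue_tuple R n.+1]_(x in @fundamental_cube R n.+1) (u x)%:E =
   \int[leb]_(t in `[0%R, (2 * pi)%R[)
     \int[lebesgue_tuple R n]_(x in @fundamental_cube R n)
       (u (tuple_cons (t, x)))%:E)%E.
Proof.
move=> mu u1.
pose P : {measure set (RR * n.-tuple RR) -> \bar R} := (leb \x lebesgue_tuple R n)%E.
pose v := EFin \o (fun z => u (tuple_cons z)).
pose D := @tuple_cons R n @^-1` @fundamental_cube R n.+1.
have DE := preimage_cube_cons n : D = _.
have mD : measurable D.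
  by rewrite DE; apply: measurableX => //; exact: measurable_fundamental_cube.
have iv : P.-integrable D v.
  apply: measurable_bounded_integrable => //.
  - by apply: le_lt_trans (ltry ((2 * pi) ^+ n.+1)); rewrite -lebesgue_cube.
  - apply: measurable_funTS; apply: measurableT_comp => //.
    exact: measurable_tuple_cons.
  - by exists 1; split => // M M1 x _ /=; rewrite (le_trans (u1 _))// ltW.
transitivity (\int[P]_(z in D) v z)%E.
  rewrite /= integral_pushforward//=.
  - exact: measurable_tuple_cons.
  - exact/measurable_EFinP.
  - exact: measurable_fundamental_cube.
(* Fubini on the whole product, for the function extended by 0 outside the cube: a section at t in
   [0, 2 pi[ is the extension of the section on the smaller cube, and any other section is 0. *)
rewrite integral_mkcond -integral12_prod_meas1; last exact: (integrable_mkcond _ mD).1.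
rewrite [RHS]integral_mkcond; apply: eq_integral => t _.
rewrite /fubini_F patchE; case: ifPn => tI.
  rewrite [RHS]integral_mkcond; apply: eq_integral => x _.
  rewrite !patchE DE; congr (if _ then _ else _).
  rewrite inE in tI.
  by apply/idP/idP; rewrite !inE/=; [case|].
rewrite integral0_eq// => x _; rewrite patchE DE; case: ifPn => //.
by rewrite inE => -[/= tI' _]; rewrite mem_set in tI.
Qed.

(** The addition formulas split off the first coordinate but mix cosine and sine, so both integrals
    go through the induction together. The inner sine integral is 0, which leaves a product of a
    one-dimensional integral with the inner cosine integral. *)
Lemma integral_phase n (k : n.-tuple int) :
  (\int[lebesgue_tuple R n]_(x in @fundamental_cube R n) (cos (phase k x))%:E =
   ([forall i, tnth k i == 0]%:R * (2 * pi) ^+ n)%:E /\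
  \int[lebesgue_tuple R n]_(x in @fundamental_cube R n) (sin (phase k x))%:E = 0)%E.
Proof.
have norm_cos (a : R) : `|cos a| <= 1 by exact: cos_max.
have norm_sin (a : R) : `|sin a| <= 1 by exact: sin_max.
elim: n k => [k|n ih k].
  have ph0 x : phase k x = 0 by rewrite /phase big_ord0.
  split.
    under eq_integral do rewrite ph0 cos0.
    rewrite integral_cst; last exact: measurable_fundamental_cube.
    rewrite mul1e (_ : [forall i, tnth k i == 0]); last by apply/forallP; case.
    by rewrite mul1r; exact: lebesgue_cube.
  by under eq_integral do rewrite ph0 sin0; rewrite integral0.
pose k' := [tuple of behead k].
have k0E : [forall i, tnth k i == 0] = (thead k == 0) && [forall i, tnth k' i == 0].
  apply/forallP/andP => [k0|[k0 /forallP k'0] i].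
    split; first exact: k0.
    apply/forallP => i; have := k0 (lift ord0 i).
    by rewrite (tuple_eta k) tnthS.
  case: (unliftP ord0 i) => [j ->|->//].
  by have := k'0 j; rewrite [in X in _ -> X](tuple_eta k) tnthS.
have [ihc ihs] := ih k'.
have mC := @measurable_fundamental_cube R n.
have ic := integrable_cube (measurable_cos_phase k') (fun x => norm_cos _).
have is_ := integrable_cube (measurable_sin_phase k') (fun x => norm_sin _).
split.
  rewrite integral_cube_cons//; last exact: measurable_cos_phase.
  under eq_integral => t _.
    under eq_integral => x _.
      rewrite phase_cons cosD EFinB 2!EFinM.
      over.
    rewrite integralB//; [|exact: integrableZl..].
    rewrite !integralZl// ihc ihs mule0 sube0 muleC.
    over.
  rewrite integralZl//; last first.
    by apply: integrable_itv2pi => //; exact: measurable_cosZ.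
  rewrite integral_cosz k0E -EFinM exprS; congr EFin.
  by case: (thead k == 0) [forall i, tnth k' i == 0] => [] [] /=; ring.
rewrite integral_cube_cons//; last exact: measurable_sin_phase.
under eq_integral => t _.
  under eq_integral => x _.
    rewrite phase_cons sinD EFinD 2!EFinM.
    over.
  rewrite integralD//; [|exact: integrableZl..].
  rewrite !integralZl// ihc ihs mule0 adde0 muleC.
  over.
rewrite integralZl//; last first.
  by apply: integrable_itv2pi => //; exact: measurable_sinZ.
by rewrite integral_sinz mule0.
Qed.

End phases.

(** * Integration on the torus and orthonormality of the characters *)

Lemma ge0_integral_mrestr {R : realType} {d} {T : measurableType d}
    (mu : {measure set T -> \bar R}) (D : set T) (mD : measurable D)
    (f : T -> \bar R) : measurable_fun setT f -> (forall x, 0 <= f x)%E ->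
  (\int[mrestr mu mD]_x f x = \int[mu]_(x in D) f x)%E.
Proof.
move=> mf f0; have mDC : measurable (~` D) by exact: measurableC.
rewrite -(setUv D) ge0_integral_setU//; last 2 first.
- by rewrite setUv.
- by apply/disj_set2P; exact: setICr.
rewrite [X in (_ + X)%E](_ : _ = 0%E) ?adde0; last first.
  apply: null_set_integral => //; first exact: measurable_funTS.
  by rewrite /= /mrestr setICl measure0.
apply: eq_measure_integral => A mA AD.
by rewrite /= /mrestr setIidl.
Qed.

Section torus_integration.
Context {R : realType} {d : nat}.
Notation RR := (measurableTypeR R).
Notation T := (torus R d).
Notation tm := (torus_measure R d).

(** The universal property of the quotient sigma-algebra. *)
Lemma measurable_fun_torus {d'} {U : measurableType d'} (u : T -> U) :
  measurable_fun setT (u \o @torus_pi R d) -> measurable_fun setT u.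
Proof.
move=> mu _ A mA; rewrite setTI.
by have := mu measurableT A mA; rewrite setTI.
Qed.

Lemma cmeasurable_torus (u : T -> R[i]) :
  cmeasurable (fun x => u (@torus_pi R d x)) -> cmeasurable u.
Proof. by move=> [? ?]; split; exact: measurable_fun_torus. Qed.

Lemma ge0_integral_torus (f : T -> \bar R) :
  measurable_fun setT f -> (forall x, 0 <= f x)%E ->
  (\int[tm]_x f x = ((2 * pi) ^- d)%:E *
    \int[lebesgue_tuple R d]_(x in @fundamental_cube R d) f (torus_pi x))%E.
Proof.
move=> mf f0; rewrite ge0_integral_mscale//=; congr (_ * _)%E.
rewrite ge0_integral_pushforward//=; last exact: measurable_torus_pi.
rewrite preimage_setT ge0_integral_mrestr//.
Qed.

Let twopi_neq0 : (2 * pi) ^+ d != 0 :> R.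
Proof. by rewrite expf_neq0// gt_eqF// mulr_gt0// pi_gt0. Qed.

Lemma torus_measureT : tm setT = 1%E.
Proof.
rewrite -[LHS]mul1e -(integral_cst tm measurableT) ge0_integral_torus//.
rewrite integral_cst; last exact: measurable_fundamental_cube.
transitivity (((2 * pi : R) ^- d)%:E * (1 * ((2 * pi) ^+ d)%:E))%E.
  by congr (_ * (_ * _))%E; exact: lebesgue_cube.
by rewrite mul1e -EFinM mulVf.
Qed.

Lemma integrable_torus_bounded (u : T -> R) (M : R) : measurable_fun setT u ->
  (forall x, `|u x| <= M) -> tm.-integrable setT (EFin \o u).
Proof.
move=> mu uM; apply: measurable_bounded_integrable => //.
  by rewrite torus_measureT ltry.
by exists M; split; [exact: num_real|move=> N MN x _ /=; rewrite (le_trans (uM x))// ltW].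
Qed.

(** The function u + 1 is nonnegative, so [ge0_integral_torus] applies to it; the constant
    contributes 1 on both sides and cancels. *)
Lemma integral_torus_bounded (u : T -> R) : measurable_fun setT u ->
  (forall x, `|u x| <= 1) ->
  (\int[tm]_x (u x)%:E = ((2 * pi) ^- d)%:E *
    \int[lebesgue_tuple R d]_(x in @fundamental_cube R d) (u (torus_pi x))%:E)%E.
Proof.
move=> mu u1.
have iu := integrable_torus_bounded mu u1.
have i1 : tm.-integrable setT (EFin \o cst 1).
  by apply: (@integrable_torus_bounded _ 1) => // x; rewrite normr1.
have I1 : (\int[tm]_x (EFin \o cst 1%R) x = 1)%E.
  transitivity (1%:E * tm setT)%E; first exact: (integral_cst tm measurableT 1%:E).
  by rewrite torus_measureT mul1e.
have IC : (\int[lebesgue_tuple R d]_(x in @fundamental_cube R d) (EFin \o cst 1%R) x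
    = ((2 * pi) ^+ d)%:E)%E.
  transitivity (1%:E * lebesgue_tuple R d (@fundamental_cube R d))%E.
    by apply: (integral_cst _ _ 1%:E); exact: measurable_fundamental_cube.
  by rewrite mul1e; exact: lebesgue_cube.
have : (\int[tm]_x (u x + 1)%:E = ((2 * pi) ^- d)%:E *
    \int[lebesgue_tuple R d]_(x in @fundamental_cube R d) (u (torus_pi x) + 1)%:E)%E.
  apply: (@ge0_integral_torus (fun x => (u x + 1)%:E)).
    by apply/measurable_EFinP; exact: measurable_funD.
  by move=> x; rewrite lee_fin -lerBlDr sub0r; have := u1 x; rewrite ler_norml => /andP[].
under eq_integral do rewrite EFinD.
rewrite (integralD measurableT iu i1) I1.
under [X in _ = (_ * X)%E -> _]eq_integral do rewrite EFinD.
have mpi := @measurable_torus_pi R d.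
rewrite (@integralD _ _ _ _ _ _ (EFin \o (fun x => u (torus_pi x))) (EFin \o cst 1)).
- rewrite IC muleDr//; last by rewrite fin_num_adde_defl.
  by rewrite -EFinM mulVf// => /(congr1 (fun z => z - 1%:E)%E); rewrite !addeK.
- exact: measurable_fundamental_cube.
- by apply: integrable_cube => //; exact: measurableT_comp.
- by apply: (integrable_cube (u := cst 1)) => // x; rewrite normr1.
Qed.

Lemma torus_pi_repr (x : T) : torus_pi (repr x) = x.
Proof. exact: reprK. Qed.

Lemma repr_torus_pi (x : d.-tuple RR) : exists m : 'I_d -> int,
  forall i, tnth (repr (torus_pi x)) i = tnth x i + (m i)%:~R * (2 * pi).
Proof.
have : torus_eq (repr (torus_pi x)) x by apply/eqmodP; rewrite reprK.
move=> /asboolP /choice[m hm]; exists m => i.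
by rewrite -hm addrC subrK.
Qed.

(** Two representatives differ by 2 pi m with m an integer vector, which shifts the phase by 2 pi
    times the integer k.m. *)
Lemma characterE (k : frequency d) (x : d.-tuple RR) :
  character k (torus_pi x) = cos (phase k x) +i* sin (phase k x).
Proof.
have [m hm] := repr_torus_pi x; rewrite /character.
have -> : \sum_(i < d) (tnth k i)%:~R * tnth (repr (torus_pi x)) i =
    phase k x + (\sum_(i < d) tnth k i * m i)%:~R * (2 * pi).
  rewrite /phase rmorph_sum/= mulr_suml -big_split/=; apply: eq_bigr => i _.
  by rewrite hm mulrDr mulrA rmorphM.
by rewrite cosD2piz sinD2piz.
Qed.

Lemma character_repr (k : frequency d) (x : T) :
  character k x = cos (phase k (repr x)) +i* sin (phase k (repr x)).
Proof. by []. Qed.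

Lemma cmeasurable_character (k : frequency d) : cmeasurable (character (R := R) k).
Proof.
apply: cmeasurable_torus; under [X in cmeasurable X]eq_fun do rewrite characterE.
by split; [exact: measurable_cos_phase|exact: measurable_sin_phase].
Qed.

Lemma sqn_character (k : frequency d) (x : T) : sqn (character k x) = 1.
Proof. by rewrite /sqn/= cos2Dsin2. Qed.

Definition frequencyD (k l : frequency d) : frequency d :=
  [tuple tnth k i + tnth l i | i < d].
Definition frequencyN (k : frequency d) : frequency d := [tuple - tnth k i | i < d].

Lemma characterM (k l : frequency d) (x : T) :
  character k x * character l x = character (frequencyD k l) x.
Proof.
have -> : character (frequencyD k l) x = cos (phase k (repr x) + phase l (repr x))
    +i* sin (phase k (repr x) + phase l (repr x)).
  rewrite character_repr /phase -big_split/=.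
  by under eq_bigr do rewrite tnth_mktuple rmorphD mulrDl.
by rewrite !character_repr cosD sinD; apply: eqRI => //=; rewrite addrC.
Qed.

Lemma characterJ (k : frequency d) (x : T) :
  ((character k x)^*)%R = character (frequencyN k) x.
Proof.
rewrite !character_repr.
have -> : phase (frequencyN k) (repr x) = - phase k (repr x).
  by rewrite /phase -sumrN; apply: eq_bigr => i _; rewrite tnth_mktuple rmorphN mulNr.
by rewrite cosN sinN.
Qed.

Lemma square_integrable_bounded (u : T -> R[i]) (M : R) : cmeasurable u ->
  (forall x, sqn (u x) <= M) -> square_integrable tm u.
Proof.
move=> mu uM; apply/square_integrableP; split => //.
have /integrableP[_] : tm.-integrable setT (EFin \o (fun x => sqn (u x))).
  apply: (@integrable_torus_bounded _ M) => [|x]; first exact: measurable_sqn.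
  by rewrite ger0_norm ?sqn_ge0.
by under eq_integral do rewrite /= ger0_norm ?sqn_ge0//.
Qed.

Lemma square_integrable_character (k : frequency d) :
  square_integrable tm (character (R := R) k).
Proof.
apply: (@square_integrable_bounded _ 1); first exact: cmeasurable_character.
by move=> x; rewrite sqn_character.
Qed.

Lemma cintegral_character (k : frequency d) :
  cintegral tm (character (R := R) k) = [forall i, tnth k i == 0]%:R.
Proof.
have [m1 m2] := cmeasurable_character k.
have [cosE sinE] := @integral_phase R d k.
apply: eqRI; rewrite /= /Rintegral.
  rewrite (integral_torus_bounded m1) => [|x]; last exact: cos_max.
  under eq_integral do rewrite /comp characterE [X in X%:E]/=.
  rewrite cosE -EFinM/= mulrCA mulVf ?mulr1//.
  by case: [forall i, _].
rewrite (integral_torus_bounded m2) => [|x]; last exact: sin_max.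
under eq_integral do rewrite /comp characterE [X in X%:E]/=.
by rewrite sinE mule0; case: [forall i, _].
Qed.

Lemma character_orthonormal (k l : frequency d) :
  inner tm (character (R := R) k) (character l) = (k == l)%:R.
Proof.
rewrite /inner.
rewrite (_ : (fun x => _) = character (frequencyD k (frequencyN l))); last first.
  by apply/funext => x; rewrite characterJ characterM.
rewrite cintegral_character; congr (_%:R).
congr nat_of_bool; apply/forallP/eqP => [kl|-> i].
  apply: eq_from_tnth => i; have := kl i.
  by rewrite !tnth_mktuple subr_eq0 => /eqP.
by rewrite !tnth_mktuple subrr.
Qed.

End torus_integration.

(** * Polynomials converging to a step function on [0, 1] *)

Section step_polynomials.
Context {R : realType}.
Implicit Types (a t u v : R) (n : nat).

Lemma bernoulli_ge a n : -1 <= a -> 1 + n%:R * a <= (1 + a) ^+ n.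
Proof.
move=> a1; elim: n => [|n ih]; first by rewrite mul0r addr0 expr0.
rewrite exprS (@le_trans _ _ ((1 + a) * (1 + n%:R * a)))//.
  by rewrite -natr1; have := mulr_ge0 (ler0n R n) (sqr_ge0 a); nra.
by rewrite ler_wpM2l// -lerBlDl sub0r.
Qed.

(** 1 - v^n is (1 - v) times 1 + v + ... + v^(n-1), a sum of n terms that are all at least v^n. For
    v < 1 this bounds n v^n by 1 / (1 - v), uniformly in n. *)
Lemma natmul_expr_le v n : 0 <= v <= 1 -> n%:R * v ^+ n * (1 - v) <= 1 - v ^+ n.
Proof.
move=> /andP[v0 v1]; elim: n => [|n ih]; first by rewrite !mul0r expr0 subrr.
rewrite exprS -natr1.
have := exprn_ge0 n v0; have := exprn_ile1 n v0 v1.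
move: (v ^+ n) (n%:R : R) ih => w m ih w1 w0.
have := ler_wpM2l v0 ih; have vw : v * w <= 1 by rewrite mulr_ile1.
have : v * w * (1 - v) <= 1 - v by rewrite ler_piMl// subr_ge0.
nra.
Qed.

Lemma cvg_natmul_expr u : 0 <= u < 1 -> n%:R * u ^+ n @[n --> \oo] --> (0 : R).
Proof.
(* With u = v^2, one factor v^n absorbs n and the other tends to 0: n u^n = (n v^n) v^n <= v^n / (1
   - v). *)
move=> /andP[u0 u1]; pose v := Num.sqrt u.
have v0 : 0 <= v := sqrtr_ge0 u.
have v1 : v < 1 by rewrite -sqrtr1 ltr_sqrt.
have uE : u = v * v by rewrite -expr2 sqr_sqrtr.
apply: (@squeeze_cvgr _ _ _ _ (cst 0) (fun n => v ^+ n * (1 - v)^-1)).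
- near=> n; rewrite mulr_ge0 ?exprn_ge0//=.
  rewrite uE exprMn mulrA mulrC ler_wpM2l ?exprn_ge0//.
  rewrite -[leRHS]mul1r ler_pdivlMr ?subr_gt0//.
  have v01 : 0 <= v <= 1 by rewrite v0 ltW.
  by have := natmul_expr_le n v01; have := exprn_ge0 n v0; lra.
- exact: cvg_cst.
- rewrite -[X in _ --> X](mul0r (1 - v)^-1); apply: cvgMl.
  by apply: cvg_expr; rewrite ger0_norm.
Unshelve. all: by end_near. Qed.

(** Multiplied by t^n it gives n (2 t)^n, and so 2^n places the threshold at t = 1/2. *)
Definition step_exponent n := (n * 2 ^ n)%N.

Lemma step_poly_bound t n : 0 <= t <= 1 ->
  0 <= (1 - t ^+ n) ^+ step_exponent n <= 1.
Proof.
move=> /andP[t0 t1].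
have := exprn_ge0 n t0; have := exprn_ile1 n t0 t1 => a1 a0.
have b0 : 0 <= 1 - t ^+ n by rewrite subr_ge0.
by rewrite exprn_ge0//= exprn_ile1// lerBlDr lerDl.
Qed.

(* (1 - t^n)^(n 2^n) is squeezed by Bernoulli: it is at least 1 - n (2 t)^n, and at most
   1 / (1 + n (2 t)^n); the factor n in the exponent decides the case t = 1/2. *)
Lemma cvg_step_poly t : 0 <= t <= 1 ->
  (1 - t ^+ n) ^+ step_exponent n @[n --> \oo] --> ((t < 2^-1)%R%:R : R).
Proof.
move=> /[dup] t01 /andP[t0 t1].
have NtE n : (step_exponent n)%:R * t ^+ n = n%:R * (2 * t) ^+ n.
  by rewrite /step_exponent natrM natrX exprMn mulrA.
have a01 n : 0 <= t ^+ n <= 1 by rewrite exprn_ge0//= exprn_ile1.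
have [th|th] := ltP t 2^-1.
  apply: (@squeeze_cvgr _ _ _ _ (fun n => 1 - n%:R * (2 * t) ^+ n) (cst 1)).
  - near=> n; have /andP[_ ->] := step_poly_bound n t01; rewrite andbT.
    rewrite -NtE -mulrN bernoulli_ge// lerN2.
    by have /andP[] := a01 n.
  - rewrite -[X in _ --> X]subr0; apply: cvgB; first exact: cvg_cst.
    apply: cvg_natmul_expr; rewrite mulr_ge0//=.
    by rewrite mulrC -ltr_pdivlMr// div1r.
  - exact: cvg_cst.
apply: (@squeeze_cvgr _ _ _ _ (cst 0) (@harmonic R)).
- near=> n; have /andP[-> _] := step_poly_bound n t01 => /=.
  have /andP[b0 b1] := a01 n.
  rewrite -[leRHS]mul1r ler_pdivlMr//.
  (* With a = t^n and N = [step_exponent n], (1 - a)^N (1 + a)^N = (1 - a^2)^N <= 1, and Bernoulli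
     gives (1 + a)^N >= 1 + n (2 t)^n >= n + 1 as 2 t >= 1. Hence the bound by the harmonic
     sequence. *)
  apply: (@le_trans _ _ ((1 - t ^+ n) ^+ step_exponent n * (1 + t ^+ n) ^+ step_exponent n)).
    rewrite ler_wpM2l ?exprn_ge0 ?subr_ge0//.
    apply: le_trans (bernoulli_ge (step_exponent n) _); last first.
      by rewrite (le_trans _ b0)// lerN10.
    rewrite NtE -natr1 addrC lerD2l -[leLHS]mulr1 ler_wpM2l//.
    by rewrite exprn_ege1// mulrC -ler_pdivrMr// div1r.
  rewrite -exprMn exprn_ile1//; first by rewrite mulr_ge0 ?subr_ge0 ?addr_ge0.
  by rewrite mulrDr mulr1 mulrBl mul1r addrA subrK lerBlDr lerDl mulr_ge0.
- exact: cvg_cst.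
- exact: cvg_harmonic.
Unshelve. all: by end_near. Qed.

End step_polynomials.

(** * Trigonometric polynomials and their L2-limits *)

Section trigonometric_approximation.
Context {R : realType} {d : nat}.
Notation RR := (measurableTypeR R).
Notation T := (torus R d).
Notation tm := (torus_measure R d).

Inductive trigpoly : (T -> R[i]) -> Prop :=
| trigpoly_char c k : trigpoly (fun x => c * character k x)
| trigpoly_add p q : trigpoly p -> trigpoly q -> trigpoly (fun x => p x + q x).

Lemma trigpoly_ext p q : trigpoly p -> p =1 q -> trigpoly q.
Proof. by move=> hp /funext <-. Qed.

Lemma character0 (x : T) : character (R := R) [tuple of nseq d 0] x = 1.
Proof.
rewrite character_repr /phase big1 ?cos0 ?sin0// => i _.
by rewrite tnth_nseq mul0r.
Qed.

Lemma trigpoly_cst c : trigpoly (fun=> c).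
Proof.
by apply: trigpoly_ext (trigpoly_char c [tuple of nseq d 0]) _ => x; rewrite character0 mulr1.
Qed.

Lemma trigpoly_mul p q : trigpoly p -> trigpoly q -> trigpoly (fun x => p x * q x).
Proof.
elim=> [c k|p1 p2 _ ih1 _ ih2 hq]; last first.
  apply: trigpoly_ext (trigpoly_add (ih1 hq) (ih2 hq)) _ => x.
  by rewrite mulrDl.
elim=> [c' k'|q1 q2 _ ih1 _ ih2].
  apply: trigpoly_ext (trigpoly_char (c * c') (frequencyD k k')) _ => x.
  by rewrite -characterM mulrACA.
by apply: trigpoly_ext (trigpoly_add ih1 ih2) _ => x; rewrite mulrDr.
Qed.

Lemma trigpolyX p n : trigpoly p -> trigpoly (fun x => p x ^+ n).
Proof.
move=> hp; elim: n => [|n ih].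
  by apply: trigpoly_ext (trigpoly_cst 1) _ => x; rewrite expr0.
by apply: trigpoly_ext (trigpoly_mul hp ih) _ => x; rewrite exprS.
Qed.

Lemma cmeasurable_trigpoly p : trigpoly p -> cmeasurable p.
Proof.
elim=> [c k|p1 p2 _ ih1 _ ih2]; last exact: cmeasurableD.
by apply: cmeasurableM; [exact: cmeasurable_cst|exact: cmeasurable_character].
Qed.

Lemma trigpoly_bounded p : trigpoly p -> exists M, forall x, sqn (p x) <= M.
Proof.
elim=> [c k|p1 p2 _ [M1 h1] _ [M2 h2]].
  by exists (sqn c) => x; rewrite sqnM sqn_character mulr1.
exists (2 * M1 + 2 * M2) => x; apply: le_trans (sqnD_le _ _) _.
by rewrite lerD// ler_wpM2l.
Qed.

(** Puts a trigonometric polynomial in the shape required by [e_total], padding its coefficients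
    with zeros. *)
Lemma trigpoly_fset p : trigpoly p -> exists A0 : {fset frequency d},
  forall A : {fset frequency d}, (A0 `<=` A)%fset ->
  exists b : frequency d -> R[i], forall x, p x = \sum_(k <- A) b k * character k x.
Proof.
elim=> [c k|p1 p2 _ [A1 h1] _ [A2 h2]].
  exists [fset k]%fset => A; rewrite fsub1set => kA.
  exists (fun l => if l == k then c else 0) => x.
  rewrite (big_fsetD1 k)//= eqxx big1_fset ?addr0// => l.
  by rewrite !inE => /andP[/negbTE -> _] _; rewrite mul0r.
exists (A1 `|` A2)%fset => A; rewrite fsubUset => /andP[/h1[b1 hb1] /h2[b2 hb2]].
exists (fun k => b1 k + b2 k) => x; rewrite hb1 hb2 -big_split/=.
by apply: eq_bigr => k _; rewrite mulrDl.
Qed.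

(** The L2-closure of the trigonometric polynomials; measurability is carried along because the
    [sqint] inequalities ask for it. *)
Definition trig_approx (h : T -> R[i]) := cmeasurable h /\
  forall r : R, 0 < r -> exists2 q, trigpoly q & (sqint tm (fun x => h x - q x)%R < r%:E)%E.

Lemma trig_approx_trigpoly p : trigpoly p -> trig_approx p.
Proof.
move=> hp; split => [|r r0]; first exact: cmeasurable_trigpoly.
exists p => //; rewrite /sqint; under eq_integral do rewrite subrr sqn0.
by rewrite integral0 lte_fin.
Qed.

Lemma trig_approx_lim h : cmeasurable h ->
  (forall r : R, 0 < r -> exists2 h', trig_approx h' &
    (sqint tm (fun x => h x - h' x)%R < r%:E)%E) ->
  trig_approx h.
Proof.
move=> mh hh; split => // r r0.
(* The two errors are doubled by [sqintB_le]: 2 (r / 4) + 2 (r / 4) = r. *)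
have r4 : 0 < r / 4 by rewrite divr_gt0.
have [h' [mh' /(_ _ r4)[q hq l2]] l1] := hh _ r4.
exists q => //; apply: le_lt_trans (sqintB_le _ mh mh' (cmeasurable_trigpoly hq)) _.
rewrite (_ : r%:E = 2%:E * (r / 4)%:E + 2%:E * (r / 4)%:E)%E; last first.
  by rewrite -!EFinM -EFinD; congr EFin; field.
by rewrite lteD// lte_pmul2l.
Qed.

Lemma trig_approxD f g : trig_approx f -> trig_approx g -> trig_approx (fun x => f x + g x).
Proof.
move=> [mf hf] [mg hg]; split => [|r r0]; first exact: cmeasurableD.
have r4 : 0 < r / 4 by rewrite divr_gt0.
have [p hp lp] := hf _ r4; have [q hq lq] := hg _ r4.
exists (fun x => p x + q x); first exact: trigpoly_add.
have mp := cmeasurable_trigpoly hp; have mq := cmeasurable_trigpoly hq.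
rewrite (_ : (fun x => _) = fun x => (f x - p x) + (g x - q x)); last first.
  by apply/funext => x; rewrite opprD addrACA.
apply: le_lt_trans (sqintD_le _ (cmeasurableB mf mp) (cmeasurableB mg mq)) _.
rewrite (_ : r%:E = 2%:E * (r / 4)%:E + 2%:E * (r / 4)%:E)%E; last first.
  by rewrite -!EFinM -EFinD; congr EFin; field.
by rewrite lteD// lte_pmul2l.
Qed.

Lemma sqintM_le (f g : T -> R[i]) (M : R) : cmeasurable f -> cmeasurable g ->
  (forall x, sqn (f x) <= M) ->
  (sqint tm (fun x => f x * g x)%R <= M%:E * sqint tm g)%E.
Proof.
move=> mf mg fM; have M0 : 0 <= M by rewrite (le_trans _ (fM point))// sqn_ge0.
rewrite -ge0_integralZl//; [|exact: measurable_EFin_sqn|by move=> x _; rewrite lee_fin sqn_ge0].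
apply: ge0_le_integral => //.
- by move=> x _; rewrite lee_fin sqn_ge0.
- by apply: measurable_EFin_sqn; exact: cmeasurableM.
- by apply: measurable_funeM; exact: measurable_EFin_sqn.
- by move=> x _; rewrite -EFinM lee_fin sqnM ler_wpM2r// sqn_ge0.
Qed.

(** Write f g - q p = f (g - q) + q (f - p). The approximant q of g is chosen first; being a
    trigonometric polynomial it has a bound K, and the tolerance for the approximant p of f depends
    on K. *)
Lemma trig_approxM f g M : trig_approx f -> (forall x, sqn (f x) <= M) ->
  trig_approx g -> trig_approx (fun x => f x * g x).
Proof.
move=> [mf hf] fM [mg hg]; split => [|r r0]; first exact: cmeasurableM.
have M0 : 0 <= M by rewrite (le_trans _ (fM point))// sqn_ge0.
(* M + 1 is positive even if M = 0, and 2 M r / (4 (M + 1)) < r / 2; the same computation serves for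
   K. *)
have r1 : 0 < r / (4 * (M + 1)) by rewrite divr_gt0// mulr_gt0// ltr_wpDl.
have [q hq lq] := hg _ r1; have mq := cmeasurable_trigpoly hq.
have [K qK] := trigpoly_bounded hq.
have K0 : 0 <= K by rewrite (le_trans _ (qK point))// sqn_ge0.
have r2 : 0 < r / (4 * (K + 1)) by rewrite divr_gt0// mulr_gt0// ltr_wpDl.
have [p hp lp] := hf _ r2; have mp := cmeasurable_trigpoly hp.
exists (fun x => q x * p x); first exact: trigpoly_mul.
rewrite (_ : (fun x => _) = fun x => f x * (g x - q x) + q x * (f x - p x)); last first.
  by apply/funext => x; ring.
apply: le_lt_trans (sqintD_le _ (cmeasurableM mf (cmeasurableB mg mq))
  (cmeasurableM mq (cmeasurableB mf mp))) _.
have small (N s : R) u : 0 <= N -> (s = r / (4 * (N + 1))) -> (u <= N%:E * s%:E)%E ->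
    (2%:E * u < (r / 2)%:E)%E.
  move=> N0 -> uN; apply: (@le_lt_trans _ _ (2%:E * (N%:E * (r / (4 * (N + 1)))%:E))%E).
    by rewrite lee_wpmul2l.
  rewrite -!EFinM lte_fin (_ : 2 * _ = (r / 2) * (N / (N + 1))); last first.
    by field; rewrite gt_eqF// ltr_wpDl.
  by rewrite gtr_pMr ?divr_gt0// ltr_pdivrMr ?ltr_wpDl// mul1r ltrDl.
rewrite (_ : r%:E = (r / 2)%:E + (r / 2)%:E)%E; last by rewrite -EFinD; congr EFin; field.
apply: lteD.
  apply: (small _ _ _ M0 erefl); apply: le_trans (sqintM_le mf (cmeasurableB mg mq) fM) _.
  by rewrite lee_wpmul2l ?lee_fin// ltW.
apply: (small _ _ _ K0 erefl); apply: le_trans (sqintM_le mq (cmeasurableB mf mp) qK) _.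
by rewrite lee_wpmul2l ?lee_fin// ltW.
Qed.

Lemma trig_approxZ c f : trig_approx f -> trig_approx (fun x => c * f x).
Proof.
apply: (@trig_approxM _ _ (sqn c)) => //.
exact/trig_approx_trigpoly/trigpoly_cst.
Qed.

Lemma trig_approx_cst c : trig_approx (fun=> c).
Proof. exact/trig_approx_trigpoly/trigpoly_cst. Qed.

Lemma trig_approxB f g : trig_approx f -> trig_approx g -> trig_approx (fun x => f x - g x).
Proof.
move=> hf /(trig_approxZ (-1)) /(trig_approxD hf).
by under [X in trig_approx X -> _]eq_fun do rewrite mulN1r.
Qed.

(** Dominated convergence is applied to the squared errors, so g dominates these. It is used with g
    = 1 for indicators and with g = u^2 for simple functions below u. *)
Lemma trig_approx_dominated (u_ : nat -> T -> R) (u g : T -> R) :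
  (forall n, trig_approx (fun x => (u_ n x)%:C)) -> measurable_fun setT u ->
  (forall x, u_ n x @[n --> \oo] --> u x) ->
  tm.-integrable setT (EFin \o g) ->
  (forall n x, (u_ n x - u x) ^+ 2 <= g x) ->
  trig_approx (fun x => (u x)%:C).
Proof.
move=> hu_ mu cu ig ug; apply: trig_approx_lim; first exact: cmeasurable_real.
move=> r r0.
have cv : (\int[tm]_x ((u_ n x - u x) ^+ 2)%:E)%E @[n --> \oo] --> (0 : \bar R)%E.
  rewrite -(integral0 tm setT).
  apply: (@dominated_cvg _ _ _ _ _ measurableT _ _ (EFin \o g)) => //.
  - move=> n; apply/measurable_EFinP/measurable_funX/measurable_funB => //.
    by have [[]] := hu_ n.
  - move=> x _; apply: cvg_EFin; first exact: nearW.
    have cB : u_ n x - u x @[n --> \oo] --> u x - u x.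
      by apply: cvgB; [exact: cu|exact: cvg_cst].
    by have := cvgM cB cB; rewrite subrr mulr0; exact.
  - by move=> n x _; rewrite gee0_abs ?lee_fin ?sqr_ge0//=.
have /cv : nbhs (0 : \bar R)%E [set z | (z < r%:E)%E].
  by apply: open_ereal_lt'; rewrite lte_fin.
move=> [N _ /(_ N (leqnn N)) lr]; exists (fun x => (u_ N x)%:C); first exact: hu_.
apply: le_lt_trans lr; rewrite le_eqVlt; apply/orP; left; apply/eqP.
apply: eq_integral => x _; rewrite -sqn_real -sqnN opprB.
by rewrite rmorphB.
Qed.

End trigonometric_approximation.

(** * Density of trigonometric polynomials in L2 of the torus *)

Section density.
Context {R : realType} {d : nat}.
Notation RR := (measurableTypeR R).
Notation T := (torus R d).
Notation tm := (torus_measure R d).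

Let twopi_gt0 : 0 < 2 * pi :> R.
Proof. by rewrite mulr_gt0// pi_gt0. Qed.

Definition approx_set (A : set T) :=
  measurable A /\ trig_approx (fun x => (\1_A x : R)%:C).

Lemma trig_approx_ext (f g : T -> R[i]) : trig_approx f -> f =1 g -> trig_approx g.
Proof. by move=> hf /funext <-. Qed.

Lemma approx_setT : approx_set setT.
Proof.
split; first exact: measurableT.
by apply: trig_approx_ext (trig_approx_cst 1) _ => x; rewrite indicT.
Qed.

Lemma approx_setC A : approx_set A -> approx_set (~` A).
Proof.
move=> [mA hA]; split; first exact: measurableC.
apply: trig_approx_ext (trig_approxB (trig_approx_cst 1) hA) _ => x.
by rewrite !indicE in_setC; case: (x \in A); rewrite /= ?subrr ?subr0.
Qed.

Lemma approx_set0 : approx_set set0.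
Proof. by rewrite -setCT; exact: approx_setC approx_setT. Qed.

Lemma approx_setI A B : approx_set A -> approx_set B -> approx_set (A `&` B).
Proof.
move=> [mA hA] [mB hB]; split; first exact: measurableI.
have A1 x : sqn ((\1_A x : R)%:C) <= 1.
  by rewrite sqn_real indicE; case: (x \in A); rewrite ?expr1n ?expr0n.
apply: trig_approx_ext (trig_approxM hA A1 hB) _ => x.
by rewrite !indicE in_setI; case: (x \in A); case: (x \in B); rewrite /= ?mulr0 ?mulr1.
Qed.

Lemma approx_setU A B : approx_set A -> approx_set B -> approx_set (A `|` B).
Proof.
move=> hA hB; rewrite -[_ `|` _]setCK setCU; apply: approx_setC.
by apply: approx_setI; exact: approx_setC.
Qed.

Lemma integrable_cst1 : tm.-integrable setT (EFin \o cst 1).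
Proof. by apply: (@integrable_torus_bounded _ _ _ 1) => // x; rewrite normr1. Qed.

Lemma approx_set_cvg (u_ : nat -> T -> R) (A : set T) :
  (forall n, trig_approx (fun x => (u_ n x)%:C)) -> measurable A ->
  (forall n x, 0 <= u_ n x <= 1) ->
  (forall x, u_ n x @[n --> \oo] --> (\1_A x : R)) -> approx_set A.
Proof.
move=> hu mA u01 cu; split => //.
apply: (trig_approx_dominated (u_ := u_) (g := cst 1)) => //.
- exact: integrable_cst1.
- move=> n x; have /andP[u0 u1] := u01 n x.
  by rewrite indicE; case: (x \in A) => /=; nra.
Qed.

Lemma approx_set_bigcup (F : (set T)^nat) :
  (forall n, approx_set (F n)) -> approx_set (\bigcup_n F n).
Proof.
move=> hF; pose G n := \big[setU/set0]_(i < n) F i.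
have hG n : approx_set (G n).
  rewrite /G; elim: n => [|n ih]; first by rewrite big_ord0; exact: approx_set0.
  by rewrite big_ord_recr; exact: approx_setU.
apply: (@approx_set_cvg (fun n => \1_(G n))).
- by move=> n; case: (hG n).
- by apply: bigcup_measurable => n _; case: (hF n).
- by move=> n x; rewrite indicE; case: (x \in _); rewrite /= ?ler01 ?lexx.
(* At each point the indicators of the partial unions are eventually constant. *)
- move=> x; have [[N _ FN]|nF] := pselect ((\bigcup_n F n) x).
    apply: cvg_near_cst; exists N.+1 => // n /= Nn; rewrite !indicE !mem_set//.
      by exists N.
    by rewrite /G -bigcup_mkord; exists N.
  apply: cvg_near_cst; apply: nearW => n; rewrite !indicE !memNset//.
  by move=> Gx; apply: nF; exact: bigsetU_bigcup Gx.
Qed.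

Lemma approx_set_lt_half (phi : T -> R) : trigpoly (fun x => (phi x)%:C) ->
  (forall x, 0 <= phi x <= 1) -> approx_set [set x | phi x < 2^-1].
Proof.
move=> hphi phi01.
apply: (@approx_set_cvg (fun n x => (1 - phi x ^+ n) ^+ step_exponent n)).
- move=> n; apply: trig_approx_trigpoly.
  have h := trigpolyX (step_exponent n) (trigpoly_add (trigpoly_cst 1)
    (trigpoly_mul (trigpoly_cst (-1)) (trigpolyX n hphi))).
  by apply: trigpoly_ext h _ => x; rewrite rmorphXn rmorphB rmorphXn rmorph1 mulN1r.
- have [mphi _] := cmeasurable_trigpoly hphi.
  rewrite -[X in measurable X]setTI (_ : [set x | _] = phi @^-1` `]-oo, 2^-1[%classic).
    exact: mphi.
  by apply/seteqP; split => x /=; rewrite in_itv.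
- by move=> n x; exact: step_poly_bound.
- move=> x; rewrite indicE (_ : x \in _ = (phi x < 2^-1)); first exact: cvg_step_poly.
  by apply/idP/idP; rewrite inE.
Qed.

(** The representative in the half-open cube; [repr] is an unspecified choice, about which neither
    location nor measurability is known. *)
Definition section_tuple (x : T) : d.-tuple RR :=
  [tuple tnth (repr x) i - (Num.floor (tnth (repr x) i / (2 * pi)))%:~R * (2 * pi) | i < d].

Lemma section_tuple_itv x i : 0 <= tnth (section_tuple x) i < 2 * pi.
Proof.
rewrite tnth_mktuple; set y : R := tnth (repr x) i.
have /andP[] := floor_itv (y / (2 * pi)).
rewrite ler_pdivlMr// ltr_pdivrMr// subr_ge0 => -> /=.
by rewrite intrD mulrDl mul1r ltrBlDl.
Qed.

Lemma section_tupleK : cancel section_tuple (@torus_pi R d).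
Proof.
move=> x; rewrite -[RHS]torus_pi_repr; apply/eqmodP; apply/asboolP => i.
exists (- Num.floor (tnth (repr x) i / (2 * pi))).
by rewrite tnth_mktuple intrN mulNr addrAC subrr add0r.
Qed.

Definition frequency_delta (i : 'I_d) : frequency d := [tuple ((j == i)%:R : int) | j < d].

Lemma character_delta (i : 'I_d) (x : T) : character (frequency_delta i) x =
  cos (tnth (section_tuple x) i) +i* sin (tnth (section_tuple x) i).
Proof.
rewrite -[in LHS](section_tupleK x) characterE.
have -> // : phase (frequency_delta i) (section_tuple x) = tnth (section_tuple x) i.
rewrite /phase (bigD1 i)//= big1 ?addr0 => [|j /negbTE ji].
  by rewrite tnth_mktuple eqxx mul1r.
by rewrite [tnth (frequency_delta i) j]tnth_mktuple ji mul0r.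
Qed.

(** On the circle, [0, a] is the arc with centre a / 2 and half-width a / 2, and t lies outside of
    it exactly when the cosine of its angular distance to the centre is below cos (a / 2). *)
Lemma cos_arc (a t : R) : 0 <= a < 2 * pi -> 0 <= t < 2 * pi ->
  (cos (t - a / 2) < cos (a / 2)) = (a < t).
Proof.
move=> /andP[a0 a1] /andP[t0 t1].
have a2 : a / 2 \in `[0, pi] by rewrite in_itv/=; apply/andP; split; lra.
have [ta|at_] := leP (t - a / 2) pi.
  rewrite -[cos (t - _)]cos_norm ltr_cos//.
    have [n0|n0] := leP 0 (t - a / 2).
      by rewrite ger0_norm//; apply/idP/idP; lra.
    by rewrite ltr0_norm//; apply/idP/idP; lra.
  rewrite in_itv/= normr_ge0/= ler_norml ta andbT; lra.
(* If t - a / 2 exceeds pi, the angular distance is 2 pi - (t - a / 2), which falls back into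
   [0, pi], where cosine decreases. *)
rewrite -cosN -(cosD2piz 1) ltr_cos//; last by rewrite in_itv/=; apply/andP; split; lra.
by apply/idP/idP; lra.
Qed.

Lemma approx_set_ray (i : 'I_d) (a : R) : approx_set [set x | a < tnth (section_tuple x) i].
Proof.
have [a0|a0] := ltP a 0.
  rewrite (_ : [set x | _] = setT); first exact: approx_setT.
  apply/seteqP; split => // x _ /=.
  by have /andP[+ _] := section_tuple_itv x i; exact: lt_le_trans.
have [a1|a1] := leP (2 * pi) a.
  rewrite (_ : [set x | _] = set0); first exact: approx_set0.
  apply/seteqP; split => // x /=; have /andP[_ h] := section_tuple_itv x i.
  by move=> /lt_trans /(_ h); rewrite ltNge a1.
(* A difference of two cosines lies in [-2, 2]; dividing by 4 and adding 1/2 moves it into [0, 1]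
   and its sign change to 1/2. *)
pose phi (x : T) : R := 2^-1 + (cos (tnth (section_tuple x) i - a / 2) - cos (a / 2)) / 4.
rewrite (_ : [set x | _] = [set x | phi x < 2^-1]); last first.
  apply/seteqP; split => x /=; rewrite /phi -(cos_arc _ (section_tuple_itv x i)) ?a0 ?a1//; lra.
apply: approx_set_lt_half; last first.
  move=> x; rewrite /phi; apply/andP.
  have := cos_le1 (tnth (section_tuple x) i - a / 2).
  have := cos_geN1 (tnth (section_tuple x) i - a / 2).
  by have := cos_le1 (a / 2); have := cos_geN1 (a / 2); split; lra.
(* w = e^(-i a / 2) / 8, so that w e^(i t) plus its conjugate is cos (t - a / 2) / 4; the constant c
   collects the rest of [phi]. *)
pose w : R[i] := (cos (a / 2) / 8) -i* (sin (a / 2) / 8).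
pose c : R[i] := (2^-1 - cos (a / 2) / 4)%:C.
have h := trigpoly_add (trigpoly_cst c) (trigpoly_add
  (trigpoly_char w (frequency_delta i)) (trigpoly_char w^* (frequencyN (frequency_delta i)))).
apply: trigpoly_ext h _ => x; rewrite -characterJ character_delta /phi cosB /w /c.
move: (cos (a / 2)) (sin (a / 2)) (cos _) (sin _) => ca sa ct st.
by apply: eqRI; rewrite !(cReD, cImD, cReM, cImM, cReJ, cImJ) /=; field.
Qed.

(** Two nested generation arguments: the sigma-algebra of tuples is generated by the coordinates,
    that of the line by the rays ]a, +oo[, and [approx_set_ray] treats the preimage of a ray under
    one coordinate. *)
Lemma approx_set_section (B : set (d.-tuple RR)) : measurable B ->
  approx_set (section_tuple @^-1` B).
Proof.
pose G := [set B | approx_set (section_tuple @^-1` B)].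
rewrite -[approx_set _]/(G B); move: B.
apply: smallest_sub.
  split => [|A|F hF]; rewrite /G/=.
  - by rewrite preimage_set0; exact: approx_set0.
  - by rewrite setTD preimage_setC => hA; exact: approx_setC hA.
  - by rewrite preimage_bigcup; exact: approx_set_bigcup.
apply: (big_ind (fun S => S `<=` G)) => [//|S1 S2 h1 h2|i _]; first by rewrite subUset.
move=> _ [C mC <-]; rewrite setTI.
pose H := [set C | G ((fun x : d.-tuple RR => tnth x i) @^-1` C)].
rewrite -[G _]/(H C); move: C mC.
have mE : (measurable : set (set RR)) = <<s @RGenOInfty.G R>> := RGenOInfty.measurableE R.
rewrite mE; apply: smallest_sub; last first.
  move=> _ [a ->]; rewrite /H /G/=.
  rewrite (_ : _ @^-1` _ = [set x | a < tnth (section_tuple x) i]).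
    exact: approx_set_ray.
  by apply/seteqP; split => x /=; rewrite in_itv/= andbT.
split => [|A hA|F hF]; rewrite /H /G/=.
- exact: approx_set0.
- by rewrite setTD; exact: approx_setC hA.
- exact: approx_set_bigcup hF.
Qed.

Lemma approx_set_measurable (A : set T) : measurable A -> approx_set A.
Proof.
move=> mA; rewrite (_ : A = section_tuple @^-1` (@torus_pi R d @^-1` A)).
  exact: approx_set_section.
by apply/seteqP; split => x /=; rewrite section_tupleK.
Qed.

Import HBNNSimple.

Lemma trig_approx_nnsfun (f : {nnsfun T >-> R}) : trig_approx (fun x => (f x)%:C).
Proof.
set s := fset_set (range f).
have hsum n (F : 'I_n -> T -> R) : (forall i, trig_approx (fun x => (F i x)%:C)) ->
    trig_approx (fun x => (\sum_(i < n) F i x)%:C).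
  elim: n F => [|n ih] F hF.
    by apply: trig_approx_ext (trig_approx_cst 0) _ => x; rewrite big_ord0.
  have hn := ih _ (fun i => hF (widen_ord (leqnSn n) i)).
  apply: trig_approx_ext (trig_approxD hn (hF ord_max)) _ => x.
  by rewrite big_ord_recr/= rmorphD.
apply: trig_approx_ext (hsum (size (finmap.enum_fset s)) (fun i x => (finmap.enum_fset s)`_i *
  \1_(f @^-1` [set (finmap.enum_fset s)`_i]) x) _) _ => [i|x]; last by rewrite (fimfunEord f x).
have [_ h] := @approx_set_measurable (f @^-1` [set (finmap.enum_fset s)`_i])
  (measurable_sfunP f (measurable_set1 _)).
by apply: trig_approx_ext (trig_approxZ ((finmap.enum_fset s)`_i)%:C h) _ => x; rewrite rmorphM.
Qed.

(** Simple functions f_n increase to u, and 0 <= f_n <= u makes u^2 a majorant of (f_n - u)^2. *)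
Lemma trig_approx_ge0 (u : T -> R) : measurable_fun setT u -> (forall x, 0 <= u x) ->
  tm.-integrable setT (EFin \o (fun x => u x ^+ 2)) -> trig_approx (fun x => (u x)%:C).
Proof.
move=> mu u0 iu.
have mu' : measurable_fun setT (EFin \o u) by exact/measurable_EFinP.
pose f_ := nnsfun_approx measurableT mu'.
have fu n x : f_ n x <= u x.
  rewrite -lee_fin /f_ nnsfun_approxE.
  by apply: (le_approx n (f := EFin \o u)) => // y _; rewrite lee_fin.
apply: (trig_approx_dominated (u_ := fun n x => f_ n x) (g := fun x => u x ^+ 2)) => //.
- by move=> n; exact: trig_approx_nnsfun.
- move=> x; have u0' y : [set: T] y -> (0 <= (EFin \o u) y)%E by rewrite lee_fin.
  have cv := cvg_nnsfun_approx measurableT mu' u0' (I : [set: T] x).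
  by have [_] := (fine_cvgP _ _).1 cv; exact.
- move=> n x; have := fu n x; have : 0 <= f_ n x by []; have := u0 x; nra.
Qed.

Lemma trig_approx_real (u : T -> R) : measurable_fun setT u ->
  tm.-integrable setT (EFin \o (fun x => u x ^+ 2)) -> trig_approx (fun x => (u x)%:C).
Proof.
move=> mu iu.
have part (v : T -> R) : measurable_fun setT v -> (forall x, 0 <= v x) ->
    (forall x, v x <= `|u x|) -> trig_approx (fun x => (v x)%:C).
  move=> mv v0 vu; apply: trig_approx_ge0 => //.
  apply: (le_integrable _ _ _ iu) => //.
    by apply/measurable_EFinP; exact: measurable_funX.
  move=> x _ /=; rewrite lee_fin !normrX ler_pXn2r ?nnegrE//.
  by rewrite ger0_norm.
have hp := part _ (measurable_funrpos mu) (funrpos_ge0 u).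
have hn := part _ (measurable_funrneg mu) (funrneg_ge0 u).
apply: trig_approx_ext (trig_approxB (hp _) (hn _)) _ => x.
- by rewrite /funrpos ge_max ler_norm normr_ge0.
- by rewrite /funrneg ge_max -normrN ler_norm normr_ge0.
- rewrite -rmorphB; congr (_%:C); rewrite /funrpos /funrneg.
  have [ux|ux] := orP (le_total 0 (u x)).
    by rewrite max_l// max_r ?oppr_le0// subr0.
  by rewrite max_r// max_l ?oppr_ge0// sub0r opprK.
Qed.

Lemma trig_approx_square_integrable (h : T -> R[i]) :
  square_integrable tm h -> trig_approx h.
Proof.
move=> hh; have [[m1 m2] _] := hh; have ih := sqint_integrable hh.
have part (u : T -> R) : measurable_fun setT u -> (forall x, u x ^+ 2 <= sqn (h x)) ->
    trig_approx (fun x => (u x)%:C).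
  move=> mu uh; apply: trig_approx_real => //.
  apply: (le_integrable _ _ _ ih) => //.
    by apply/measurable_EFinP; exact: measurable_funX.
  by move=> x _ /=; rewrite lee_fin !ger0_norm ?sqr_ge0 ?sqn_ge0.
have h1 := part _ m1 (fun x => _); have h2 := part _ m2 (fun x => _).
apply: trig_approx_ext (trig_approxD (h1 _) (trig_approxZ (0 +i* 1) (h2 _))) _ => x.
- by rewrite /= /sqn lerDl sqr_ge0.
- by rewrite /= /sqn lerDr sqr_ge0.
- by apply: eqRI; rewrite !(cReD, cImD, cReM, cImM)/=; ring.
Qed.

(** Discharges [e_total] for the characters. *)
Lemma character_total (h : T -> R[i]) (r : R) : square_integrable tm h -> 0 < r ->
  exists A0 : {fset frequency d}, forall A : {fset frequency d}, (A0 `<=` A)%fset ->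
  exists b, (sqint tm (fun x => h x - \sum_(k <- A) b k * character k x)%R < r%:E)%E.
Proof.
move=> /trig_approx_square_integrable[_ hh] r0.
have [q hq lq] := hh _ r0; have [A0 hA0] := trigpoly_fset hq.
exists A0 => A /hA0[b hb]; exists b; apply: le_lt_trans lq.
rewrite le_eqVlt; apply/orP; left; apply/eqP.
by apply: eq_integral => x _; rewrite hb.
Qed.

End density.

(** * Sums over frequencies as integrals for the counting measure *)

Section countable_counting.
Context {R : realType} {d : nat}.
Notation F := (frequency d).

(** By injectivity of [pickle] each fiber is empty or a singleton, so the fibers partition the
    frequencies into a sequence of sets of measure at most 1; this yields sigma-finiteness and
    reduces integrals to series. *)
Let fiber (n : nat) : set F := [set k | choice.pickle k = n].

Let fiber_cover : \bigcup_n fiber n = setT.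
Proof. by apply/seteqP; split => // k _; exists (choice.pickle k). Qed.

Let fiber_triv : trivIset setT fiber.
Proof.
apply/trivIsetP => i j _ _ /eqP ij; apply/seteqP; split => // k [/= ki kj].
by apply: ij; rewrite -ki.
Qed.

Let fiber_case n : fiber n = set0 \/ exists k, fiber n = [set k].
Proof.
have [->|/set0P[k kn]] := eqVneq (fiber n) set0; [by left|right; exists k].
by apply/seteqP; split => [l|_ ->//] /= ln; apply: (pcan_inj choice.pickleK); rewrite ln kn.
Qed.

Let counting1 (k : F) : counting [set k] = 1%E :> \bar R.
Proof. by rewrite /counting asboolT// fset_set1 cardfs1. Qed.

Lemma measurable_frequency {d'} {U : measurableType d'} (u : F -> U) : measurable_fun setT u.
Proof. by move=> _ B mB. Qed.

Lemma sigma_finite_counting_frequency : sigma_finite setT (counting : {measure set F -> \bar R}).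
Proof.
exists fiber => // n; split => //.
have [->|[k ->]] := fiber_case n; first by rewrite measure0 ltry.
by apply: le_lt_trans (ltry 1); rewrite -(counting1 k).
Qed.

Let counting_measure : {measure set F -> \bar R} := @counting F R.

(* Packed by hand: the canonical sigma-finite structure that mathcomp-analysis attaches
   to [counting] is the one of the counting measure of nat. *)
Definition counting_frequency : {sigma_finite_measure set F -> \bar R} :=
  HB.pack_for {sigma_finite_measure set F -> \bar R} (Measure.sort counting_measure)
    (Measure_isSigmaFinite.Build _ F R counting_measure sigma_finite_counting_frequency).

Lemma ge0_integral_counting_esum (a : F -> \bar R) : (forall k, 0 <= a k)%E ->
  (\int[counting]_k a k = \esum_(k in setT) a k)%E.
Proof.
move=> a0.
have mfib n : measurable (fiber n) by [].
have := @ge0_integral_bigcup _ _ _ (counting : {measure set F -> \bar R}) fiber a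
  mfib (measurable_funTS (measurable_frequency a)) (fun x _ => a0 x) fiber_triv.
rewrite fiber_cover => ->.
rewrite -[in RHS]fiber_cover esum_bigcupT// -nneseries_esumT; last by move=> n; exact: esum_ge0.
apply: eq_eseriesr => n _.
have [->|[k ->]] := fiber_case n; first by rewrite integral_set0 esum_set0.
rewrite esum_set1// (eq_integral (cst (a k))) => [|l /[!inE] ->//].
by rewrite integral_cst//= counting1 mule1.
Qed.

End countable_counting.

(** * The product of the frequencies with the parameter space *)

Section frequency_product.
Context {R : realType} {d : nat} {dX : measure_display} {X : measurableType dX}.
Variable mu : {sigma_finite_measure set X -> \bar R}.
Notation F := (frequency d).

(** A preimage is a countable union of slices, one for each frequency. *)
Lemma measurable_frequency_prod {d'} {U : measurableType d'} (u : F * X -> U) :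
  (forall k, measurable_fun setT (fun y => u (k, y))) -> measurable_fun setT u.
Proof.
move=> mu_ _ B mB; rewrite setTI.
rewrite (_ : _ @^-1` _ = \bigcup_k ([set k] `*` ((fun y => u (k, y)) @^-1` B))).
  apply: countable_bigcupT_measurable => // k; apply: measurableX => //.
  by rewrite -[X in measurable X]setTI; exact: mu_.
apply/seteqP; split => [[k y] /= Bu|[k y] [_ _ [/= <-]]//].
by exists k.
Qed.

Lemma cmeasurable_frequency_prod (u : F * X -> R[i]) :
  (forall k, cmeasurable (fun y => u (k, y))) -> cmeasurable u.
Proof. by move=> h; split; apply: measurable_frequency_prod => k; case: (h k). Qed.

Lemma measurable_esum_frequency (a : F * X -> \bar R) : measurable_fun setT a ->
  (forall z, 0 <= a z)%E ->
  measurable_fun setT (fun y => \esum_(k in [set: F]) a (k, y)).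
Proof.
move=> ma a0; under [X in measurable_fun _ X]eq_fun do rewrite -ge0_integral_counting_esum//.
exact: (measurable_fun_fubini_tonelli_G (m1 := counting_frequency) a ma a0).
Qed.

Lemma integral_frequency_measure (a : F * X -> \bar R) : measurable_fun setT a ->
  (forall z, 0 <= a z)%E ->
  (\int[frequency_measure d mu]_z a z = \int[mu]_y \esum_(k in [set: F]) a (k, y))%E.
Proof.
move=> ma a0; rewrite [LHS](fubini_tonelli2 (m1 := counting_frequency) a ma a0).
by apply: eq_integral => y _; exact: ge0_integral_counting_esum.
Qed.

Lemma esum_term_le (a : F -> \bar R) (k : F) :
  (a k <= \esum_(l in [set: F]) a l)%E.
Proof.
by apply: esum_ge; exists [set k]; [split|rewrite fsbig_set1].
Qed.

(** By Tonelli the sum over k of |u - v|^2 vanishes for almost every y, and then so does each term.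
    Thus a change of representative on the product affects only a null set of y, common to all k. *)
Lemma ae_frequency_prod (u v : F * X -> R[i]) : cmeasurable u -> cmeasurable v ->
  {ae frequency_measure d mu, forall z, u z = v z} ->
  {ae mu, forall y, forall k, u (k, y) = v (k, y)}.
Proof.
move=> mu_ mv uv; have muv := cmeasurableB mu_ mv.
have m2 := measurable_EFin_sqn muv.
have s0 z : (0 <= (sqn (u z - v z))%:E)%E by rewrite lee_fin sqn_ge0.
have : sqint (frequency_measure d mu) (fun z => u z - v z) = 0%E.
  rewrite (sqint_ae_eq (g := fun=> 0)) //; last 2 first.
  - exact: cmeasurable_cst.
  - by apply: filterS uv => z ->; rewrite subrr.
  by rewrite /sqint; under eq_integral do rewrite sqn0; rewrite integral0.
rewrite /sqint integral_frequency_measure// => I0.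
have me := measurable_esum_frequency m2 s0.
have e0 y : (0 <= \esum_(k in [set: F]) (sqn (u (k, y) - v (k, y)))%:E)%E by exact: esum_ge0.
have := (ae_eq_integral_abs mu measurableT me).1.
under eq_integral do rewrite gee0_abs//.
move=> /(_ I0); apply: filterS => y /(_ I) ey k.
apply/eqP; rewrite -subr_eq0; apply/eqP/sqn_eq0/eqP; rewrite eq_le sqn_ge0 andbT.
rewrite -lee_fin -[leRHS]/(cst 0%E y) -ey.
exact: (esum_term_le (fun k => (sqn (u (k, y) - v (k, y)))%:E)).
Qed.

End frequency_product.

(** * Parametric integrals and Tonelli for squared norms *)

Section parametric_integrals.
Context {R : realType} {d1 d2 : measure_display}.
Context {T1 : measurableType d1} {T2 : measurableType d2}.
Variable m : {sigma_finite_measure set T1 -> \bar R}.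

(** The integrals of the positive and negative parts are measurable in y by Tonelli. Every y is
    covered, integrable section or not, because [able_coef] is a total function of y. *)
Lemma measurable_Rintegral_param (u : T1 * T2 -> R) : measurable_fun setT u ->
  measurable_fun setT (fun y => Rintegral m setT (fun x => u (x, y))).
Proof.
move=> mu; have mu' : measurable_fun setT (EFin \o u) by exact/measurable_EFinP.
apply: (measurableT_comp (f := fine)) => //.
have -> : (fun y => \int[m]_x (u (x, y))%:E)%E =
    (fun y => \int[m]_x (EFin \o u)^\+ (x, y) - \int[m]_x (EFin \o u)^\- (x, y))%E.
  apply/funext => y; rewrite [LHS]integralE.
  by congr (_ - _)%E; apply: eq_integral => x _; rewrite ?funeposE ?funenegE.
apply: emeasurable_funB; apply: measurable_fun_fubini_tonelli_G => //.
  exact/measurable_funepos.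
exact/measurable_funeneg.
Qed.

Lemma cmeasurable_cintegral_param (u : T1 * T2 -> R[i]) : cmeasurable u ->
  cmeasurable (fun y => cintegral m (fun x => u (x, y))).
Proof.
move=> [m1 m2]; split.
  exact: (measurable_Rintegral_param m1).
exact: (measurable_Rintegral_param m2).
Qed.

Variable n : {sigma_finite_measure set T2 -> \bar R}.

Lemma sqint_swap (u : T1 * T2 -> R[i]) : cmeasurable u ->
  (\int[m]_x sqint n (fun y => u (x, y)) = \int[n]_y sqint m (fun x => u (x, y)))%E.
Proof.
move=> mu; apply: (fubini_tonelli (m1 := m) (m2 := n) (fun z => (sqn (u z))%:E)).
  exact: measurable_EFin_sqn.
by move=> z; rewrite lee_fin sqn_ge0.
Qed.

Lemma measurable_sqint1 (u : T1 * T2 -> R[i]) : cmeasurable u ->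
  measurable_fun setT (fun x => sqint n (fun y => u (x, y))).
Proof.
move=> mu; apply: (measurable_fun_fubini_tonelli_F (m2 := n) (fun z => (sqn (u z))%:E)).
  exact: measurable_EFin_sqn.
by move=> z; rewrite lee_fin sqn_ge0.
Qed.

Lemma measurable_sqint2 (u : T1 * T2 -> R[i]) : cmeasurable u ->
  measurable_fun setT (fun y => sqint m (fun x => u (x, y))).
Proof.
move=> mu; apply: (measurable_fun_fubini_tonelli_G (m1 := m) (fun z => (sqn (u z))%:E)).
  exact: measurable_EFin_sqn.
by move=> z; rewrite lee_fin sqn_ge0.
Qed.

(** Together with [sqint_swap] and [integral_sqint_eq0_ae], this passes from
    [for almost every y, almost every x] to [for almost every x, almost every y]. *)
Lemma integral_sqint_eq0 (u : T1 * T2 -> R[i]) : cmeasurable u ->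
  {ae n, forall y, {ae m, forall x, u (x, y) = 0}} ->
  (\int[n]_y sqint m (fun x => u (x, y)) = 0)%E.
Proof.
move=> mu u0; rewrite -(integral0 n setT); apply: ge0_ae_eq_integral => //.
- exact: measurable_sqint2.
- by move=> y _; exact: sqint_ge0.
- apply: filterS u0 => y u0 _.
  rewrite (sqint_ae_eq (g := fun=> 0)) //.
  + by rewrite /sqint; under eq_integral do rewrite sqn0; rewrite integral0.
  + exact: cmeasurable_comp (pair2_measurable y) mu.
  + exact: cmeasurable_cst.
Qed.

Lemma integral_sqint_eq0_ae (u : T1 * T2 -> R[i]) : cmeasurable u ->
  (\int[m]_x sqint n (fun y => u (x, y)) = 0)%E ->
  {ae m, forall x, {ae n, forall y, u (x, y) = 0}}.
Proof.
move=> mu I0; have ms := measurable_sqint1 mu.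
have := (ae_eq_integral_abs m measurableT ms).1.
under eq_integral do rewrite gee0_abs ?sqint_ge0//.
move=> /(_ I0); apply: filterS => x /(_ I) sx.
by apply: sqint_eq0 sx; exact: cmeasurable_comp (pair1_measurable x) mu.
Qed.

End parametric_integrals.

(** * The transform: isometry, Fourier sums and inversion *)

Section able_transform.
Context {R : realType} {d : nat} {dX : measure_display} {X : measurableType dX}.
Variables (mu : {sigma_finite_measure set X -> \bar R}) (p : torus R d * X -> R).
Hypothesis mp : measurable_fun setT p.
Hypothesis p_ge0 : forall xy, 0 <= p xy.
Hypothesis p1 : forall x, (\int[mu]_y (p (x, y))%:E = 1)%E.
Notation T := (torus R d).
Notation tm := (torus_measure R d).
Notation F := (frequency d).
Implicit Types f g : T -> R[i].

Lemma sigma_finite_torus_measure : sigma_finite setT tm.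
Proof.
exists (fun=> setT); first by apply/seteqP; split => // x _; exists 0%N.
by move=> _; split => //; rewrite torus_measureT ltry.
Qed.

Definition torus_sigma_finite : {sigma_finite_measure set T -> \bar R} :=
  HB.pack_for {sigma_finite_measure set T -> \bar R} (Measure.sort tm)
    (Measure_isSigmaFinite.Build _ T R tm sigma_finite_torus_measure).

(** The functions h_y of the overview, taken jointly in (x, y) so that Tonelli applies. *)
Definition weighted f (z : T * X) : R[i] := f z.1 * (Num.sqrt (p z))%:C.

Lemma measurable_sqrtp : measurable_fun setT (fun z => Num.sqrt (p z)).
Proof.
apply: measurableT_comp mp; apply: continuous_measurable_fun.
exact: sqrt_continuous.
Qed.

Lemma cmeasurable_weighted f : cmeasurable f -> cmeasurable (weighted f).
Proof.
move=> mf; apply: cmeasurableM; last by apply: cmeasurable_real; exact: measurable_sqrtp.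
exact: cmeasurable_comp measurable_fst mf.
Qed.

Lemma cmeasurable_weighted_section f y : cmeasurable f ->
  cmeasurable (fun x => weighted f (x, y)).
Proof. by move=> mf; exact: cmeasurable_comp (pair2_measurable y) (cmeasurable_weighted mf). Qed.

(** The weight is real, hence fixed by conjugation, and can be moved from the basis function to
    f. *)
Lemma able_coefE f (k : F) (y : X) :
  able_coef p f (k, y) = inner tm (fun x => weighted f (x, y)) (character k).
Proof.
congr cintegral; apply/funext => x; rewrite /able_basis /weighted/=.
by rewrite rmorphM mulrA; congr (_ * _ * _); rewrite [LHS]conjc_real.
Qed.

Lemma cmeasurable_able_coef f : cmeasurable f -> cmeasurable (able_coef p f).
Proof.
move=> mf; apply: cmeasurable_frequency_prod => k.
rewrite (_ : (fun y => _) = fun y => cintegral torus_sigma_finite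
    (fun x => weighted f (x, y) * ((character k x)^*)%R)); last first.
  by apply/funext => y; rewrite able_coefE.
apply: (@cmeasurable_cintegral_param _ _ _ _ _ _
  (fun z => weighted f z * ((character k z.1)^*)%R)).
apply: cmeasurableM; first exact: cmeasurable_weighted.
apply: cmeasurableJ.
exact: cmeasurable_comp measurable_fst (cmeasurable_character k).
Qed.

Lemma integral_sqint_weighted f : cmeasurable f ->
  (\int[mu]_y sqint tm (fun x => weighted f (x, y)) = sqint tm f)%E.
Proof.
move=> mf; rewrite -[LHS](sqint_swap torus_sigma_finite mu (cmeasurable_weighted mf)).
apply: eq_integral => x _.
rewrite /sqint -[RHS]mule1 -(p1 x) -ge0_integralZl//.
- apply: eq_integral => y _.
  by rewrite -EFinM /weighted sqnM sqn_real sqr_sqrtr.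
- by apply/measurable_EFinP; exact: measurable_fun_pair2 mp.
- by move=> y _; rewrite lee_fin.
- by rewrite lee_fin sqn_ge0.
Qed.

Lemma ae_square_integrable_weighted f : square_integrable tm f ->
  {ae mu, forall y, square_integrable tm (fun x => weighted f (x, y))}.
Proof.
move=> /square_integrableP[mf foo].
have : mu.-integrable setT (fun y => sqint tm (fun x => weighted f (x, y))).
  apply/integrableP; split.
    exact: (measurable_sqint2 torus_sigma_finite (cmeasurable_weighted mf)).
  under eq_integral do rewrite gee0_abs ?sqint_ge0//.
  by rewrite integral_sqint_weighted.
move=> /(integrable_ae measurableT); apply: filterS => y /(_ I) fy.
apply/square_integrableP; split; first exact: cmeasurable_weighted_section.
by rewrite ltey_eq fy.
Qed.

Lemma able_has_sum f y : square_integrable tm (fun x => weighted f (x, y)) ->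
  L2_has_sum tm (fun k x => able_coef p f (k, y) * character k x)
    (fun x => weighted f (x, y)).
Proof.
move=> hy; have h := fourier_has_sum square_integrable_character character_orthonormal
  character_total hy.
by under eq_fun => k do under eq_fun => x do rewrite able_coefE.
Qed.

Lemma integral_esum_able_coef f : square_integrable tm f ->
  (\int[mu]_y (\esum_(k in [set: F]) (sqn (able_coef p f (k, y)))%:E) = sqint tm f)%E.
Proof.
move=> hf; have [mf _] := hf.
have mc := cmeasurable_able_coef mf.
have sq0 z : (0 <= (sqn (able_coef p f z))%:E)%E by rewrite lee_fin sqn_ge0.
rewrite -integral_sqint_weighted//; apply: ge0_ae_eq_integral => //.
- exact: (measurable_esum_frequency (measurable_EFin_sqn mc)).
- exact: (measurable_sqint2 torus_sigma_finite (cmeasurable_weighted mf)).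
- by move=> y _; exact: esum_ge0.
- by move=> y _; exact: sqint_ge0.
- apply: filterS (ae_square_integrable_weighted hf) => y hy _.
  rewrite -(parseval square_integrable_character character_orthonormal character_total hy).
  by apply: eq_esum => k _; rewrite able_coefE.
Qed.

Lemma sqint_able_coef f : square_integrable tm f ->
  sqint (frequency_measure d mu) (able_coef p f) = sqint tm f.
Proof.
move=> hf; have [mf _] := hf.
rewrite -integral_esum_able_coef// /sqint integral_frequency_measure//.
- by apply: measurable_EFin_sqn; exact: cmeasurable_able_coef.
- by move=> z; rewrite lee_fin sqn_ge0.
Qed.

Lemma square_integrable_able_coef f : square_integrable tm f ->
  square_integrable (frequency_measure d mu) (able_coef p f).
Proof.
move=> hf; apply/square_integrableP; split.
  by apply: cmeasurable_able_coef; case: hf.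
by rewrite sqint_able_coef//; have /square_integrableP[] := hf.
Qed.

Lemma able_coef_ae_eq f g : cmeasurable f -> cmeasurable g ->
  {ae tm, forall x, f x = g x} -> able_coef p f = able_coef p g.
Proof.
move=> mf mg fg; apply/funext => -[k y]; rewrite !able_coefE.
have mchar := cmeasurableJ (cmeasurable_character (R := R) k).
apply: cintegral_ae_eq.
- by apply: cmeasurableM => //; exact: cmeasurable_weighted_section.
- by apply: cmeasurableM => //; exact: cmeasurable_weighted_section.
- by apply: filterS fg => x; rewrite /weighted /= => ->.
Qed.

(** For almost every y, S (., y) and h_y are L2-sums of the same series and therefore agree almost
    everywhere in x. The order of the two quantifiers is then exchanged through the double integral
    of |S - h|^2. *)
Lemma fourier_sum_ae_eq f (c : F * X -> R[i]) (S : T * X -> R[i]) :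
  square_integrable tm f -> cmeasurable c ->
  {ae frequency_measure d mu, forall z, able_coef p f z = c z} ->
  is_fourier_sum mu c S ->
  {ae tm, forall x, {ae mu, forall y, S (x, y) = weighted f (x, y)}}.
Proof.
move=> hf mc fc [mS hS]; have [mf _] := hf.
have mw := cmeasurable_weighted mf.
have mSw : cmeasurable (fun z => S z - weighted f z) by exact: cmeasurableB.
have I0 : (\int[mu]_y sqint tm (fun x => (S (x, y) - weighted f (x, y))%R) = 0)%E.
  apply: (integral_sqint_eq0 (m := torus_sigma_finite) mSw).
  have := ae_frequency_prod (cmeasurable_able_coef mf) mc fc.
  apply: filterS3 hS (ae_square_integrable_weighted hf) => y hSy hwy fcy.
  have := able_has_sum hwy.
  under [X in L2_has_sum _ X]eq_fun => k do under eq_fun => x do rewrite fcy.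
  move=> hw; have := L2_has_sum_unique _ hSy hw.
  move=> /(_ (fun k => cmeasurableM (cmeasurable_cst _) (cmeasurable_character k))).
  by apply: filterS => x ->; rewrite subrr.
rewrite -(sqint_swap torus_sigma_finite mu mSw) in I0.
have := integral_sqint_eq0_ae (m := torus_sigma_finite) mSw I0.
apply: filterS => x; apply: filterS => y /eqP.
by rewrite subr_eq0 => /eqP.
Qed.

(** Existence of a jointly measurable Fourier sum: the series are not summed again, since
    [weighted f] is measurable on the product and has the right sections. *)
Lemma is_fourier_sum_weighted f (c : F * X -> R[i]) :
  square_integrable tm f -> cmeasurable c ->
  {ae frequency_measure d mu, forall z, able_coef p f z = c z} ->
  is_fourier_sum mu c (weighted f).
Proof.
move=> hf mc fc; have [mf _] := hf; split; first exact: cmeasurable_weighted.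
have := ae_frequency_prod (cmeasurable_able_coef mf) mc fc.
apply: filterS2 (ae_square_integrable_weighted hf) => y hwy fcy.
have := able_has_sum hwy.
by under [X in L2_has_sum _ X]eq_fun => k do under eq_fun => x do rewrite fcy.
Qed.

(** Everything happens at a fixed x: the integrand agrees for almost every y with p (x, y) times the
    constant f x, and inherits its integrability from p (x, .), whose integral is 1. *)
Lemma able_inversion f (S : T * X -> R[i]) (x : T) : cmeasurable S ->
  {ae mu, forall y, S (x, y) = weighted f (x, y)} ->
  cintegrable mu (fun y => S (x, y) * (Num.sqrt (p (x, y)))%:C) /\
  f x = cintegral mu (fun y => S (x, y) * (Num.sqrt (p (x, y)))%:C).
Proof.
move=> mS Sx.
have mpx : measurable_fun setT (fun y => p (x, y)) by exact: measurable_fun_pair2 mp.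
have ip : mu.-integrable setT (EFin \o (fun y => p (x, y))).
  apply/integrableP; split; first exact/measurable_EFinP.
  under eq_integral do rewrite gee0_abs ?lee_fin//.
  by rewrite p1 ltry.
have ipC : cintegrable mu (fun y => (p (x, y))%:C).
  by split => //; exact: integrable0.
have mSx : cmeasurable (fun y => S (x, y) * (Num.sqrt (p (x, y)))%:C).
  apply: cmeasurableM; first exact: cmeasurable_comp (pair1_measurable x) mS.
  apply: cmeasurable_real; exact: measurable_fun_pair2 measurable_sqrtp.
have ifp := cintegrableZ (f x) ipC.
have SE : {ae mu, forall y, f x * (p (x, y))%:C = S (x, y) * (Num.sqrt (p (x, y)))%:C}.
  apply: filterS Sx => y ->; rewrite /weighted -mulrA -rmorphM/=.
  by rewrite -expr2 sqr_sqrtr.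
split.
  have [i1 i2] := ifp; have [m1 m2] := mSx.
  split; [apply: (integrable_ae_eq i1)|apply: (integrable_ae_eq i2)].
  - exact/measurable_EFinP.
  - by apply: filterS SE => y /= ->.
  - exact/measurable_EFinP.
  - by apply: filterS SE => y /= ->.
rewrite -(cintegral_ae_eq (cintegrable_cmeasurable ifp) mSx SE) cintegralZ//.
rewrite (_ : cintegral mu _ = 1) ?mulr1//.
apply: eqRI; first by rewrite /= /Rintegral p1.
by rewrite /= /Rintegral integral0.
Qed.

End able_transform.

(** * Classes of square-integrable functions, and the final assembly *)

Section L2_classes.
Context {R : realType} {d : measure_display} {T : measurableType d}.
Variable mu : {measure set T -> \bar R}.
Implicit Types f g : L2fun mu.

Lemma L2class_eqP f g : L2class f = L2class g <-> {ae mu, forall x, f x = g x}.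
Proof.
split => [/eqmodP /asboolP//|fg].
by apply/eqmodP/asboolP.
Qed.

Lemma L2class_repr (F : L2space mu) : L2class (L2space_fun F) = F.
Proof. exact: reprK. Qed.

Lemma L2space_fun_class f : {ae mu, forall x, L2space_fun (L2class f) x = f x}.
Proof. by apply/L2class_eqP; rewrite L2class_repr. Qed.

Lemma cmeasurable_L2fun f : cmeasurable f.
Proof. by case: f => f []. Qed.

End L2_classes.

Theorem theorem1 (R : realType) (d : nat) (dX : measure_display)
    (X : measurableType dX) (mu : {sigma_finite_measure set X -> \bar R})
    (p : torus R d * X -> R) :
  (0 < d)%N ->
  measurable_fun setT p ->
  (forall xy, 0 <= p xy) ->
  (forall x, (\int[mu]_y (p (x, y))%:E = 1)%E) ->
  exists hA : forall f : L2fun (torus_measure R d),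
    square_integrable (frequency_measure d mu) (able_coef p f),
  exists A : L2space (torus_measure R d) -> L2space (frequency_measure d mu),
  [/\ forall f, A (L2class f) = L2class (MkL2fun (hA f)),
      set_bij setT (range A) A,
      forall f : L2fun (torus_measure R d),
        (L2norm (torus_measure R d) f ^+ 2 =
           L2norm (frequency_measure d mu) (A (L2class f)) ^+ 2 /\
         L2norm (frequency_measure d mu) (A (L2class f)) ^+ 2 =
           \int[mu]_y \esum_(k in [set: frequency d])
             (normc (able_coef p f (k, y)) ^+ 2)%:E)%E &
      forall Ainv : L2space (frequency_measure d mu) ->
          L2space (torus_measure R d),
        cancel A Ainv ->
        forall g : L2fun (frequency_measure d mu), range A (L2class g) ->
          (exists S, is_fourier_sum mu g S) /\
          forall S, is_fourier_sum mu g S ->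
            {ae torus_measure R d, forall x,
              cintegrable mu (fun y => S (x, y) * (Num.sqrt (p (x, y)))%:C) /\
              Ainv (L2class g) x =
                cintegral mu (fun y => S (x, y) * (Num.sqrt (p (x, y)))%:C)}].
Proof.
move=> _ mp p0 p1.
have sq_fun (f : L2fun (torus_measure R d)) : square_integrable (torus_measure R d) f.
  exact: L2funP.
pose hA (f : L2fun (torus_measure R d)) := square_integrable_able_coef mp p0 p1 (sq_fun f).
exists hA.
(* The transform acts on a representative; [AE] shows that the choice is immaterial, as functions
   equal almost everywhere have the same coefficient at every (k, y). *)
pose A (F : L2space (torus_measure R d)) : L2space (frequency_measure d mu) :=
  L2class (MkL2fun (hA (L2space_fun F))).
have coef_meas (f : L2fun (torus_measure R d)) : cmeasurable (able_coef p f).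
  by apply: cmeasurable_able_coef => //; exact: cmeasurable_L2fun.
have AE f : A (L2class f) = L2class (MkL2fun (hA f)).
  apply/L2class_eqP => /=; rewrite (able_coef_ae_eq mp _ _ (L2space_fun_class f)).
  - exact: nearW.
  - exact: cmeasurable_L2fun.
  - exact: cmeasurable_L2fun.
have A_inj : injective A.
  move=> F G /L2class_eqP /= FG; rewrite -[F]L2class_repr -[G]L2class_repr.
  apply/L2class_eqP.
  set f := L2space_fun F in FG *; set g := L2space_fun G in FG *.
  (* [weighted p f] is a Fourier sum for the coefficients of g as well, so the inversion formula
     with this single S returns both f x and g x. *)
  have fgS := is_fourier_sum_weighted mp p0 p1 (sq_fun f) (coef_meas g) FG.
  have gg : {ae frequency_measure d mu, forall z, able_coef p g z = able_coef p g z}.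
    exact: nearW.
  have := fourier_sum_ae_eq mp p0 p1 (sq_fun g) (coef_meas g) gg fgS.
  apply: filterS => x fgx.
  have [_ ->] := able_inversion mp p0 p1 (cmeasurable_weighted mp (cmeasurable_L2fun f)) fgx.
  have [_ ->//] := able_inversion mp p0 p1 (f := f) (x := x)
    (cmeasurable_weighted mp (cmeasurable_L2fun f)) (nearW _ (fun y => erefl)).
exists A; split.
- exact: AE.
- split => [x _|F G _ _|y //]; first by exists x.
  exact: A_inj.
- move=> f; rewrite !L2norm_sqr.
  have NA : sqint (frequency_measure d mu) (A (L2class f)) = sqint (torus_measure R d) f.
    rewrite AE (sqint_ae_eq _ _ (L2space_fun_class (MkL2fun (hA f)))).
    + exact: sqint_able_coef.
    + exact: cmeasurable_L2fun.
    + exact: cmeasurable_L2fun.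
  split; first exact: esym NA.
  rewrite [LHS]NA -(integral_esum_able_coef mp p0 p1 (sq_fun f)).
  by apply: eq_integral => y _; apply: eq_esum => k _; rewrite normc_sqr.
move=> Ainv AK g [F _ AF]; rewrite -AF AK.
set f := L2space_fun F.
(* g is an arbitrary representative of a class in the image, so it agrees with the coefficients of f
   only almost everywhere. *)
have fg : {ae frequency_measure d mu, forall z, able_coef p f z = g z}.
  exact: (@L2class_eqP _ _ _ _ (MkL2fun (hA f)) g).1 AF.
split.
  exists (weighted p f).
  exact: (is_fourier_sum_weighted mp p0 p1 (sq_fun f) (cmeasurable_L2fun g) fg).
move=> S hS.
have := fourier_sum_ae_eq mp p0 p1 (sq_fun f) (cmeasurable_L2fun g) fg hS.
apply: filterS => x Sx; case: hS => mS _.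
exact: (able_inversion mp p0 p1 mS Sx).
Qed.
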